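(* Let $\big((x_t^* )_{t=0}^{T},(u_t^* )_{t=0}^{T-1}\big)$ be an optimal state-action trajectory for the optimal control problem $$\min \sum_{t=0}^{T-1} c_t(x_t,u_t)\quad\text{subject to}\quad \begin{cases} x_{t+1}=f_t(x_t)+g_t(x_t)\,u_t, & t=0,\dots,T-1,\\ x_t\in S_t, & t=0,\dots,T,\\ u_t\in U_t, & t=0,\dots,T-1,\\ \mathscr F(u_0,\dots,u_{T-1})=\sum_{t=0}^{T-1}F_tu_t=0, &\end{cases}$$ where the data are as described in the context, $c_t(\xi,\cdot):U_t\to\mathbb R$ is convex for every $\xi\in\mathbb R^d$ and $t=0,\dots,T-1$, and $U_t$ is convex, compact and non-empty for each $t=0,\dots,T-1$. For each $t=0,\dots,T$ let $q^x_t(x_t^* )$ be a tent of $S_t$ at $x_t^*$. For $\theta\in\mathbb R$, $\gamma\in(\mathbb R^{\ell})^\star$, $\zeta\in(\mathbb R^{d})^\star$, $s\in\{0,\dots,T-1\}$, $\xi\in\mathbb R^d$, $\mu\in\mathbb R^m$ define the Hamiltonian $$H^{\theta,\gamma}(\zeta,s,\xi,\mu)=\langle \zeta,f_s(\xi)+g_s(\xi)\mu\rangle-\theta\,c_s(\xi,\mu)-\langle\gamma,F_s\mu\rangle\in\mathbb R .$$ Then there exist a trajectory $(\eta^f_t)_{t=0}^{T-1}\subset(\mathbb R^d)^\star$, a sequence $(\eta^x_t)_{t=0}^{T}\subset(\mathbb R^d)^\star$, and a pair $(\eta^C,\eta^u)\in\mathbb R\times(\mathbb R^\ell)^\star$ such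 that: (i) (non-negativity) $\eta^C\ge 0$; (ii) (non-triviality) $(\eta^f_t)_{t=0}^{T-1}$ and $(\eta^C,\eta^u)$ do not simultaneously vanish; (iii) (state and adjoint dynamics) $$x^*_{t+1}=\tfrac{\partial}{\partial\zeta}H^{\eta^C,\eta^u}(\eta^f_t,t,x^*_t,u^*_t)\ \text{ for } t=0,\dots,T-1,$$ $$\eta^f_{t-1}=\tfrac{\partial}{\partial\xi}H^{\eta^C,\eta^u}(\eta^f_t,t,x^*_t,u^*_t)-\eta^x_t\ \text{ for } t=1,\dots,T-1,$$ where $\eta^x_t$ lies in the dual cone of $q^x_t(x^*_t)$; (iv) (transversality) $$\tfrac{\partial}{\partial\xi}H^{\eta^C,\eta^u}(\eta^f_0,0,x^*_0,u^*_0)-\eta^x_0=0\quad\text{and}\quad \eta^f_{T-1}=-\eta^x_T,$$ where $\eta^x_0$ lies in the dual cone of $q^x_0(x^*_0)$ and $\eta^x_T$ lies in the dual cone of $q^x_T(x^*_T)$; (v) (Hamiltonian maximization, pointwise in time) $$H^{\eta^C,\eta^u}(\eta^f_t,t,x^*_t,u^*_t)=\max_{\mu\in U_t}H^{\eta^C,\eta^u}(\eta^f_t,t,x^*_t,\mu)\quad\text{for } t=0,\dots,T-1;$$ (vi) (frequency constraints) $\mathscr F(u^*_0,\dots,u^*_{T-1})=0$.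
   Context: Data: $T,d,m$ are positive integers; for $t=0,\dots,T-1$ the maps $f_t:\mathbb R^d\to\mathbb R^d$, $g_t:\mathbb R^d\to\mathbb R^{d\times m}$ and $c_t:\mathbb R^d\times\mathbb R^m\to\mathbb R$ are continuously differentiable; $S_t\subset\mathbb R^d$ ($t=0,\dots,T$) are non-empty sets and $U_t\subset\mathbb R^m$. The minimization is over all state and control sequences satisfying the constraints (in particular $x_0$ ranges over $S_0$). An optimal state-action trajectory is a feasible pair attaining the minimum. $V^\star$ is the dual space of $V$; $(\mathbb R^n)^\star$ is identified with $\mathbb R^n$ via the standard inner product $\langle\cdot,\cdot\rangle$, and partial derivatives are regarded as gradients. Frequency constraint map: for $u=(u_0,\dots,u_{T-1})\in(\mathbb R^m)^T$ let $u^{(k)}\in\mathbb R^T$ ($k=1,\dots,m$) be the sequence of $k$-th components. Let $\Phi\in\mathbb C^{T\times T}$ be the DFT matrix with entries $\Phi_{\xi t}=T^{-1/2}e^{-2\pi i\xi t/T}$, $\xi,t=0,\dots,T-1$, and $\bar\Phi=\mathrm{blkdiag}(\Phi,\dots,\Phi)\in\mathbb C^{mT\times mT}$. For each $k$ a set $W^{(k)}\subset\{0,\dots,T-1\}$ of allowed frequencies is given; $D^{(k)}$ is the matrix formed by the rows $e_\xi$ of the identity $I_T$ with $\xi\notin W^{(k)}$, and $D=\mathrm{blkdiag}(D^{(1)},\dots,D^{(m)})$. Let $L\in\mathbb R^{mT\times mT}$ be the permutation matrix mapping the stacked vector $(u^{(1)},\dots,u^{(m)})$ to $(u_0,\dots,u_{T-1})$.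 Form $\begin{pmatrix}D\,\mathrm{Re}\,\bar\Phi\\ D\,\mathrm{Im}\,\bar\Phi\end{pmatrix}L^{-1}$, eliminate its zero rows if necessary, let $\ell$ be the resulting number of rows, and partition its columns as $[F_0\ F_1\ \cdots\ F_{T-1}]$ with $F_t\in\mathbb R^{\ell\times m}$. Then $\mathscr F(u_0,\dots,u_{T-1})=\sum_{t=0}^{T-1}F_tu_t$; the constraint $\mathscr F=0$ says that the DFT of $u^{(k)}$ is supported in $W^{(k)}$ for every $k$. Tents: a set $K\subset\mathbb R^n$ is a cone with vertex $v$ if $K=v+K'$ with $K'$ a non-empty set closed under multiplication by every $\alpha\ge0$. Let $\Omega\subset\mathbb R^n$ and $v\in\Omega$. A convex cone $Q$ with vertex $v$ is a tent of $\Omega$ at $v$ if there is a smooth map $\psi$ defined in a neighbourhood of $v$ such that $\psi(z)=z+o(z-v)$ and, for some $\epsilon>0$, $\psi(z)\in\Omega$ for all $z\in Q\cap B_\epsilon(v)$. The dual cone of a convex cone $K$ with vertex $v$ is $\{y\in(\mathbb R^n)^\star:\langle y,z-v\rangle\le0\ \text{for all } z\in K\}$. *)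

(* Defs.v *)
From HB Require Import structures.
From mathcomp Require Import all_boot all_order all_algebra.
From mathcomp Require Import all_classical all_reals all_analysis.
From mathcomp Require Import complex.
Set Implicit Arguments.
Unset Strict Implicit.
Unset Printing Implicit Defensive.
Import Order.TTheory GRing.Theory Num.Theory.
Import numFieldNormedType.Exports.
Local Open Scope classical_set_scope.
Local Open Scope ring_scope.

(* R^n is 'cV[R]_n, and its dual is identified with it through [inner]. *)

Definition inner (R : realType) (n : nat) (a b : 'cV[R]_n) : R :=
  \sum_(i < n) a i 0 * b i 0.

Definition gradient (R : realType) (n : nat) (h : 'cV[R]_n -> R)
    (z : 'cV[R]_n) : 'cV[R]_n :=
  \col_(i < n) 'D_(delta_mx i 0) h z.

(* For a finite-dimensional V, pointwise continuity of y |-> 'd h y is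
   continuity for the operator norm. *)
Definition C1_at (R : realType) (V W : normedModType R) (h : V -> W) (z : V) :
    Prop :=
  differentiable h z /\ forall v : V, {for z, continuous (fun y => 'd h y v)}.

Definition continuously_differentiable (R : realType) (V W : normedModType R)
    (h : V -> W) : Prop :=
  forall z, C1_at h z.

Definition is_cone (R : realType) (n : nat) (v : 'cV[R]_n)
    (K : set 'cV[R]_n) : Prop :=
  exists K' : set 'cV[R]_n,
    [/\ K' !=set0,
        forall (a : R) (z : 'cV[R]_n), 0 <= a -> K' z -> K' (a *: z)
      & K = [set v + z | z in K']].

Definition dual_cone (R : realType) (n : nat) (v : 'cV[R]_n)
    (K : set 'cV[R]_n) : set 'cV[R]_n :=
  [set y | forall z, K z -> inner y (z - v) <= 0].

(* psi is a total function here; only its values near v matter, since eps can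
   be decreased. "Smooth" means C^1 in a neighbourhood of v. *)
Definition is_tent (R : realType) (n : nat) (Omega : set 'cV[R]_n)
    (v : 'cV[R]_n) (Q : set 'cV[R]_n) : Prop :=
  [/\ Omega v,
      @convex_set R 'cV[R]_n Q,
      is_cone v Q
    & exists psi : 'cV[R]_n -> 'cV[R]_n,
        [/\ \forall z \near v, C1_at psi z,
            (fun z => psi z - z) =o_v (fun z => z - v)
          & exists2 eps : R, 0 < eps &
              forall z, Q z -> ball v eps z -> Omega (psi z)]].

Definition is_maximum_on (R : realType) (X : Type) (A : set X) (h : X -> R)
    (y : R) : Prop :=
  (exists2 a, A a & h a = y) /\ (forall a, A a -> h a <= y).

Section FrequencyConstraint.
Variables (R : realType) (T m : nat).

Definition expi (theta : R) : R[i] := Complex (cos theta) (sin theta).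

Definition dft_mx : 'M[R[i]]_T :=
  \matrix_(xi < T, t < T)
    ((Num.sqrt T%:R)^-1%:C%C * expi (- (2 * pi * xi%:R * t%:R / T%:R))).

Definition blk_dft_mx : 'M[R[i]]_(\sum_(k < m) T) := \mxdiag_(k < m) dft_mx.

Variable W : 'I_m -> {set 'I_T}.

Definition forbidden_mx (k : 'I_m) : 'M[R]_(#|~: W k|, T) :=
  rowsub (fun i => enum_val i) 1%:M.

Definition blk_forbidden_mx :
    'M[R]_(\sum_(k < m) #|~: W k|, \sum_(k < m) T) :=
  \mxblock_(k < m, j < m) (if k == j then forbidden_mx k else 0).

Lemma stack_size : (\sum_(t < T) m = \sum_(k < m) T)%N.
Proof. by rewrite !sum_nat_const !card_ord mulnC. Qed.

(* L, mapping \mxcol_k u^(k) to \mxcol_t u_t. The (t, k) block of L, of size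
   m x T, has its only nonzero entry at (k, t): the k-th component of u_t is
   the t-th component of u^(k). The cast only makes the type square. *)
Definition reorder_mx : 'M[R]_(\sum_(k < m) T) :=
  castmx (stack_size, erefl)
    (\mxblock_(t < T, k < m) (delta_mx k t : 'M[R]_(m, T))).

Definition freq_mx_full :
    'M[R]_(\sum_(k < m) #|~: W k| + \sum_(k < m) #|~: W k|,
           \sum_(t < T) m) :=
  castmx (erefl, esym stack_size)
    (col_mx (blk_forbidden_mx *m map_mx (@complex.Re R) blk_dft_mx)
            (blk_forbidden_mx *m map_mx (@complex.Im R) blk_dft_mx)
     *m invmx reorder_mx).

Definition freq_rows :=
  [set i | row i freq_mx_full != 0]%SET.

Definition freq_dim : nat := #|freq_rows|.

Definition freq_mx : 'M[R]_(freq_dim, \sum_(t < T) m) :=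
  rowsub (fun i : 'I_freq_dim => enum_val i) freq_mx_full.

Definition freq_blk (t : 'I_T) : 'M[R]_(freq_dim, m) := submxrow freq_mx t.

Definition freq_map (u : 'I_T -> 'cV[R]_m) : 'cV[R]_freq_dim :=
  \sum_(t < T) freq_blk t *m u t.

End FrequencyConstraint.

Section ControlProblem.
Variables (R : realType) (T d m : nat).
Variables (f : 'I_T -> 'cV[R]_d -> 'cV[R]_d)
          (g : 'I_T -> 'cV[R]_d -> 'M[R]_(d, m))
          (c : 'I_T -> 'cV[R]_d -> 'cV[R]_m -> R)
          (S : 'I_T.+1 -> set 'cV[R]_d)
          (U : 'I_T -> set 'cV[R]_m)
          (W : 'I_m -> {set 'I_T}).

(* For t : 'I_T, the time instants t and t + 1 among 0, ..., T. *)
Definition time_now (t : 'I_T) : 'I_T.+1 := widen_ord (leqnSn T) t.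
Definition time_next (t : 'I_T) : 'I_T.+1 := lift ord0 t.

Definition feasible (x : 'I_T.+1 -> 'cV[R]_d) (u : 'I_T -> 'cV[R]_m) : Prop :=
  [/\ forall t : 'I_T, x (time_next t) = f t (x (time_now t)) + g t (x (time_now t)) *m u t,
      forall t : 'I_T.+1, S t (x t),
      forall t : 'I_T, U t (u t)
    & freq_map W u = 0].

Definition total_cost (x : 'I_T.+1 -> 'cV[R]_d) (u : 'I_T -> 'cV[R]_m) : R :=
  \sum_(t < T) c t (x (time_now t)) (u t).

Definition optimal (x : 'I_T.+1 -> 'cV[R]_d) (u : 'I_T -> 'cV[R]_m) : Prop :=
  feasible x u /\
  forall x' u', feasible x' u' -> total_cost x u <= total_cost x' u'.

Definition hamiltonian (theta : R) (gamma : 'cV[R]_(freq_dim R W))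
    (zeta : 'cV[R]_d) (s : 'I_T) (xi : 'cV[R]_d) (mu : 'cV[R]_m) : R :=
  inner zeta (f s xi + g s xi *m mu) - theta * c s xi mu
  - inner gamma (freq_blk R W s *m mu).

End ControlProblem.

(* Main.v *)
Require Import Defs.
From HB Require Import structures.
From mathcomp Require Import all_boot all_order all_algebra.
From mathcomp Require Import all_classical all_reals all_analysis.
From mathcomp Require Import ring lra.
Import Order.TTheory GRing.Theory Num.Theory.
Import numFieldNormedType.Exports.
Local Open Scope classical_set_scope.
Local Open Scope ring_scope.

(** Near the optimal pair the problem is an ordinary constrained minimization
    over a convex set. A tent comes with a map psi that fixes its vertex, has
    the identity as derivative there, and sends the nearby points of the cone
    q_t into S_t ([tent_retraction]). Substituting x_t = psi_t (xi_t), the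
    optimal pair becomes a local minimum of the total cost, as a function of
    (xi, mu) in the convex set M of the pairs with xi_t in q_t and mu_t in U_t,
    under the finitely many scalar equations given by the dynamics and by the
    frequency map.

    For such a problem [fritz_john] provides multipliers. Let L be the
    derivative of the vector of all the functions, cost first. The directions
    L (y - v), with y in M, together with the direction of increasing cost span
    a convex cone in a finite-dimensional space. If it is not the whole space,
    a nonzero functional is nonnegative on it ([cone_separation]), and its
    coordinates are the multipliers. If it is the whole space, v is not a
    minimum: both signs of each basis vector come from a direction inside M, a
    fixed-point argument corrects the second-order errors by a combination of
    these directions, and it yields a point of M that satisfies the equations at
    a strictly smaller cost ([open_image_not_minimal]). The contraction needs
    the increments of the functions to be controlled between any two points near
    v, so the calculus is that of strict differentiability, which C^1 functions
    satisfy ([strict_C1]) and which passes to compositions.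

    The multiplier inequality is then read one variable at a time. Moving only
    xi_t gives the dual cone condition for a vector etax_t which is by definition
    the defect of the adjoint equation; moving only mu_t gives the first-order
    condition for the Hamiltonian, which is concave in the control because the
    dynamics are affine and the cost is convex in it, so that the first-order
    condition is a maximum condition. *)

Set Implicit Arguments.
Unset Strict Implicit.
Unset Printing Implicit Defensive.

(** * Separation of convex cones *)

Definition convex_cone (R : realType) (V : lmodType R) (C : set V) : Prop :=
  [/\ C 0, forall y z, C y -> C z -> C (y + z)
    & forall (a : R) y, 0 <= a -> C y -> C (a *: y)].

Lemma le_mx_entry (R : realType) (p n : nat) (A : 'M[R]_(p, n)) i j :
  `|A i j| <= `|A|.
Proof. by rewrite {2}/Num.norm /= mx_normrE; exact: (le_bigmax _ _ (i, j)). Qed.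

(** The slope is a = sup {t | e - t c in C}, which is finite because c is an
    order unit of C. If adding the line let the cone reach - c, then C itself
    would contain e - t c for some t > a, or a negative multiple of c. *)
Lemma cone_add_line (R : realType) (V : lmodType R) (C : set V) (c e : V) :
  convex_cone C -> (forall y, exists t : R, C (t *: c + y)) -> ~ C (- c) ->
  exists (C' : set V) (a : R),
    [/\ convex_cone C', C `<=` C', ~ C' (- c),
        C' (e - a *: c) & C' (a *: c - e)].
Proof.
move=> [C0 CD CZ] Cunit Cc.
have Cneg t : t < 0 -> ~ C (t *: c).
  move=> t0 Ct; apply: Cc.
  have := CZ (- t)^-1 _ _ Ct; rewrite scalerA invrN mulNr mulVf ?lt_eqF//.
  by rewrite scaleN1r; apply; rewrite oppr_ge0 invr_le0 ltW.
pose A := [set t : R | C (e - t *: c)].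
have [t0 Ct0] := Cunit e.
have [s Cs] := Cunit (- e).
have A0 : A !=set0 by exists (- t0); rewrite /A /= scaleNr opprK addrC.
have Aub : ubound A s.
  move=> t At; rewrite leNgt; apply/negP => st; apply: (Cneg (s - t)).
    by rewrite subr_lt0.
  by have := CD _ _ Cs At; rewrite addrA subrK scalerBl.
have supA : has_sup A by split=> //; exists s.
pose a := sup A.
exists [set y | exists2 r : R, C (y + r *: (e - a *: c)) & True], a; split.
- split=> [|y z [r Cr _] [r' Cr' _]|b y b0 [r Cr _]].
  + by exists 0 => //; rewrite scale0r addr0.
    exists (r + r') => //; rewrite scalerDl addrACA; exact: CD.
  by exists (b * r) => //; rewrite -scalerA -scalerDr; exact: CZ.
- by move=> y Cy; exists 0 => //; rewrite scale0r addr0.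
- move=> [r Cr _]; have [r0|r0|r0] := ltgtP r 0; last first.
  + by apply: Cc; move: Cr; rewrite r0 scale0r addr0.
  (* A multiple of e - (a + r^-1) c lies in C, against the choice of a. *)
  + have : A (a + r^-1).
      have := CZ r^-1 _ _ Cr; rewrite scalerDr scalerA mulVf ?gt_eqF// scale1r.
      rewrite invr_ge0 ltW// /A /= scalerDl opprD scalerN addrCA.
      by rewrite [X in C (e + X)]addrC; exact.
    by move/(sup_upper_bound supA); rewrite gerDl leNgt invr_gt0 r0.
  (* Some t in A exceeds a + r^-1, and C then contains a negative multiple of c. *)
  + have ra : 0 < - r^-1 by rewrite oppr_gt0 invr_lt0.
    have [t At ta] := sup_adherent ra supA.
    apply: (Cneg (a + r^-1 - t)); first by rewrite subr_lt0 -[r^-1]opprK.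
    have := CZ (- r^-1) _ (ltW ra) Cr.
    rewrite scalerDr scalerA mulNr mulVf ?lt_eqF// scaleN1r scaleNr scalerN opprK.
    move=> /(CD _ _ At); rewrite opprB [r^-1 *: c + _]addrA [_ - e]addrC addrACA subrr add0r.
    by rewrite [- _ + _]addrC [r^-1 *: c + _]addrC -scalerDl -scalerBl.
- by exists (-1) => //; rewrite scaleN1r subrr.
- by exists 1 => //; rewrite scale1r addrC addrA subrK subrr.
Qed.

(** Adding to C a line through e_i - a_i c for each basis vector e_i keeps - c
    out and makes every y equal to (sum_i y_i a_i) c modulo the lineality space,
    so w_i = a_i is the functional. *)
Lemma cone_functional (R : realType) (n : nat) (C : set 'rV[R]_n) (c : 'rV[R]_n) :
  convex_cone C -> (forall y, exists t : R, C (t *: c + y)) -> ~ C (- c) ->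
  exists2 w : 'cV[R]_n, w != 0 & forall y, C y -> 0 <= (y *m w) 0 0.
Proof.
move=> coneC Cunit Cc.
have [C' [a [[C0 CD CZ] CC' Cc' Cl]]] : exists (C' : set 'rV[R]_n) (a : nat -> R),
    [/\ convex_cone C', C `<=` C', ~ C' (- c) &
      forall i : 'I_n, (i < n)%N -> C' (delta_mx 0 i - a i *: c) /\
        C' (a i *: c - delta_mx 0 i)].
  suff: forall k, exists (C' : set 'rV[R]_n) (a : nat -> R),
    [/\ convex_cone C', C `<=` C', ~ C' (- c) &
      forall i : 'I_n, (i < k)%N -> C' (delta_mx 0 i - a i *: c) /\
        C' (a i *: c - delta_mx 0 i)] by apply.
  elim=> [|k [C1 [a [cone1 CC1 Cc1 Cl1]]]]; first by exists C, (fun=> 0); split.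
  have [kn|nk] := ltnP k n; last first.
    by exists C1, a; split=> // i _; apply: Cl1; exact: leq_trans (ltn_ord i) nk.
  have C1unit y : exists t : R, C1 (t *: c + y).
    by have [t Ct] := Cunit y; exists t; exact: CC1.
  have [C2 [b [cone2 CC2 Cc2 Cl2 Cl2']]] :=
    cone_add_line (delta_mx 0 (Ordinal kn)) cone1 C1unit Cc1.
  exists C2, (fun i => if i == k then b else a i); split=> //.
    exact: subset_trans CC2.
  move=> i; rewrite ltnS leq_eqVlt => /predU1P[ik|ik].
    by rewrite ik eqxx; have -> : i = Ordinal kn by exact: val_inj.
  rewrite (ltn_eqF ik); have [? ?] := Cl1 _ ik; split; exact: CC2.
pose w : 'cV[R]_n := \col_i a i.
have Cw y : C' ((y *m w) 0 0 *: c - y).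
  have -> : (y *m w) 0 0 *: c - y =
      \sum_i y 0 i *: (a i *: c - delta_mx 0 i).
    under [RHS]eq_bigr => i _ do rewrite scalerBr scalerA.
    rewrite sumrB -scaler_suml [X in _ - X]row_sum_delta mxE.
    by congr (_ *: _ - _); apply: eq_bigr => i _; rewrite !mxE.
  elim/big_ind: _ => // i _; have [C1 C2] := Cl i (ltn_ord i).
  have [y0|y0] := leP 0 (y 0 i); first exact: CZ.
  by rewrite -[y 0 i]opprK scaleNr -scalerN opprB; apply: CZ => //; rewrite oppr_ge0 ltW.
have Cneg t : C' (t *: c) -> 0 <= t.
  move=> Ct; rewrite leNgt; apply/negP => t0; apply: Cc'.
  have := CZ (- t)^-1 _ _ Ct; rewrite scalerA invrN mulNr mulVf ?lt_eqF//.
  by rewrite scaleN1r; apply; rewrite oppr_ge0 invr_le0 ltW.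
exists w; last first.
  by move=> y /CC' Cy; apply: Cneg; have := CD _ _ Cy (Cw y); rewrite addrC subrK.
apply/eqP => w0; apply: Cc'; have := Cw c; rewrite w0 mulmx0 mxE scale0r sub0r.
by [].
Qed.

(** Either C spans a proper subspace, which some functional annihilates, or C
    contains a basis. The second case supplies the order unit that
    [cone_functional] asks for. *)
Lemma annihilator_or_basis (R : realType) (n : nat) (C : set 'rV[R]_n) :
  (exists2 w : 'cV[R]_n, w != 0 & forall y, C y -> y *m w = 0) \/
  (exists2 B : 'M[R]_n, B \in unitmx & forall i, C (row i B)).
Proof.
have [|noann] := pselect (exists2 w : 'cV[R]_n, w != 0 & forall y, C y -> y *m w = 0).
  by left.
right.
suff H : forall k, (k <= n)%N ->
    exists2 B : 'M[R]_(k, n), row_free B & forall i, C (row i B).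
  by have [B Bfree CB] := H n (leqnn n); exists B => //; rewrite -row_free_unit.
elim=> [_|k IH kn]; first by exists 0 => [|[]//]; rewrite /row_free mxrank0.
have [B Bfree CB] := IH (ltnW kn).
have [y Cy yB] : exists2 y, C y & ~~ (y <= B)%MS.
  apply/not_exists2P => CleB; apply: noann.
  have coker0 : cokermx B != 0.
    by rewrite -mxrank_eq0 mxrank_coker (eqP Bfree) -lt0n subn_gt0.
  have [j wj] : exists j, col j (cokermx B) != 0.
    apply/not_existsP => c0; case/eqP: coker0; apply/matrixP => i j.
    have /negP/negPn/eqP/matrixP/(_ i 0) := c0 j.
    by rewrite !mxE.
  exists (col j (cokermx B)) => // y Cy.
  have [//|/negP/negPn] := CleB y.
  by rewrite submxE => /eqP yB; rewrite colE mulmxA yB mul0mx.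
have sB : (B <= col_mx y B)%MS by rewrite -addsmxE addsmxSr.
have sy : (y <= col_mx y B)%MS by rewrite -addsmxE addsmxSl.
have CyB : forall i : 'I_(1 + k), C (row i (col_mx y B)).
  by move=> i; case: (split_ordP i) => j ->; rewrite ?rowKu ?row_id ?rowKd.
exists (col_mx y B : 'M[R]_(1 + k, n)).
  rewrite /row_free eqn_leq rank_leq_row /= -{1}(eqP Bfree).
  apply: rank_ltmx; rewrite ltmxE sB /=; apply: contra yB.
  exact: submx_trans.
exact: CyB.
Qed.

(** When C contains a basis, the sum c of the basis vectors is an order unit.
    If - c belongs to C too, then C absorbs every vector. *)
Lemma cone_separation (R : realType) (n : nat) (C : set 'rV[R]_n) :
  convex_cone C ->
  (exists2 w : 'cV[R]_n, w != 0 & forall y, C y -> 0 <= (y *m w) 0 0) \/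
  (forall y, C y).
Proof.
move=> coneC; have [C0 CD CZ] := coneC.
have [[w w0 Cw]|[B Bunit CB]] := annihilator_or_basis C.
  by left; exists w => // y /Cw ->; rewrite mxE.
have Csum (a : 'I_n -> R) : (forall i, 0 <= a i) -> C (\sum_i a i *: row i B).
  by move=> a0; elim/big_ind: _ => // i _; exact: CZ.
pose c := \sum_i row i B.
have Cunit y : exists t, C (t *: c + y).
  pose b := y *m invmx B; exists `|b|.
  have -> : `|b| *: c + y = \sum_i (`|b| + b 0 i) *: row i B.
    under [RHS]eq_bigr => i _ do rewrite scalerDl.
    rewrite big_split /= -scaler_sumr; congr (_ + _).
    by rewrite -mulmx_sum_row mulmxKV.
  apply: Csum => i; rewrite -lerBlDr sub0r.
  by rewrite (le_trans (ler_norm _))// normrN le_mx_entry.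
have [Cc|Cc] := pselect (C (- c)); last first.
  by left; exact: cone_functional coneC Cunit Cc.
right => y; have [t Ct] := Cunit y.
have [t0|/ltW t0] := leP 0 t.
  by have := CD _ _ (CZ _ _ t0 Cc) Ct; rewrite scalerN addKr.
have Cc' : C c by elim/big_ind: c {Cunit Cc Ct} => // i _; exact: CB.
have := CD _ _ (CZ (- t) _ _ Cc') Ct; rewrite scaleNr addKr; apply.
by rewrite oppr_ge0.
Qed.

(** * Strict differentiability *)

(** Frechet differentiability with the increment taken between two arbitrary
    points near z. The derivative L is a bare function, so that derivatives of
    composites can be written as ordinary lambda terms; linearity and
    boundedness are part of the predicate. *)
Definition strictly_differentiable (R : realType) (V W : normedModType R)
    (h : V -> W) (z : V) (L : V -> W) : Prop :=
  [/\ linear L,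
      exists2 C : R, 0 <= C & forall v, `|L v| <= C * `|v|
    & forall e : R, 0 < e -> exists2 r : R, 0 < r &
        forall a b, `|a - z| < r -> `|b - z| < r ->
          `|h a - h b - L (a - b)| <= e * `|a - b|].

Lemma linear_propB (R : realType) (V W : lmodType R) (L : V -> W) :
  linear L -> forall a b, L (a - b) = L a - L b.
Proof. by move=> linL a b; rewrite addrC -scaleN1r linL scaleN1r addrC. Qed.

Lemma linear_prop0 (R : realType) (V W : lmodType R) (L : V -> W) :
  linear L -> L 0 = 0.
Proof. by move=> linL; rewrite -[X in L X](subrr 0) (linear_propB linL) subrr. Qed.

Lemma linear_propZ (R : realType) (V W : lmodType R) (L : V -> W) :
  linear L -> forall a v, L (a *: v) = a *: L v.
Proof. by move=> linL a v; have := linL a v 0; rewrite (linear_prop0 linL) !addr0. Qed.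

Lemma linear_propD (R : realType) (V W : lmodType R) (L : V -> W) :
  linear L -> forall a b, L (a + b) = L a + L b.
Proof. by move=> linL a b; have := linL 1 a b; rewrite !scale1r. Qed.

Section StrictCalculus.
Variables (R : realType) (V : normedModType R).

Lemma strict_lipschitz (W : normedModType R) (h : V -> W) z L :
  strictly_differentiable h z L ->
  exists2 C : R, 0 < C & exists2 r : R, 0 < r &
    forall a b, `|a - z| < r -> `|b - z| < r -> `|h a - h b| <= C * `|a - b|.
Proof.
case=> _ [C C0 LC] /(_ 1 ltr01) [r r0 hr]; exists (C + 1); first exact: ltr_wpDl.
exists r => // a b az bz.
rewrite -[h a - h b](subrK (L (a - b))) mulrDl addrC (le_trans (ler_normD _ _))//.
by rewrite lerD// hr.
Qed.

Lemma strict_linear (W : normedModType R) (L : V -> W) z (C : R) :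
  linear L -> 0 <= C -> (forall v, `|L v| <= C * `|v|) ->
  strictly_differentiable L z L.
Proof.
move=> linL C0 LC; split=> //; first by exists C.
move=> e e0; exists 1 => // a b _ _.
by rewrite (linear_propB linL) subrr normr0 mulr_ge0// ltW.
Qed.

Lemma strict_cst (W : normedModType R) (w : W) (z : V) :
  strictly_differentiable (fun=> w) z (fun=> 0 : W).
Proof.
split=> [a x y||e e0]; first by rewrite scaler0 addr0.
  by exists 0 => // v; rewrite normr0 mul0r.
by exists 1 => // a b _ _; rewrite subrr subr0 normr0 mulr_ge0// ltW.
Qed.

Lemma strict_add (W : normedModType R) (h k : V -> W) z L M :
  strictly_differentiable h z L -> strictly_differentiable k z M ->
  strictly_differentiable (fun y => h y + k y) z (fun v => L v + M v).
Proof.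
move=> [linL [C C0 LC] hL] [linM [D D0 MD] kM]; split.
- by move=> a x y; rewrite linL linM scalerDr addrACA.
- exists (C + D) => [|v]; first exact: addr_ge0.
  by rewrite mulrDl (le_trans (ler_normD _ _))// lerD.
- move=> e e0; have e20 : 0 < e / 2 by rewrite divr_gt0.
  have [r r0 hr] := hL _ e20; have [s s0 ks] := kM _ e20.
  exists (Num.min r s) => [|a b]; first by rewrite lt_min r0.
  rewrite !lt_min => /andP[ar as_] /andP[br bs].
  rewrite [e]splitr mulrDl !opprD (AC (2*2*2) ((1*3*5)*(2*4*6))).
  by rewrite (le_trans (ler_normD _ _))// lerD ?hr ?ks.
Qed.

Lemma strict_scale (W : normedModType R) (h : V -> W) z L (c : R) :
  strictly_differentiable h z L ->
  strictly_differentiable (fun y => c *: h y) z (fun v => c *: L v).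
Proof.
move=> [linL [C C0 LC] hL]; split.
- by move=> a x y; rewrite linL scalerDr !scalerA mulrC.
- exists (`|c| * C) => [|v]; first by rewrite mulr_ge0.
  by rewrite normrZ -mulrA ler_wpM2l.
- move=> e e0; have c0 : 0 < `|c| + 1 by rewrite ltr_wpDl.
  have [|r r0 hr] := hL (e / (`|c| + 1)); first by rewrite divr_gt0.
  exists r => // a b ar br; rewrite -!scalerBr normrZ.
  rewrite (le_trans (ler_wpM2l _ (hr _ _ ar br)))// mulrA ler_wpM2r//.
  by rewrite mulrCA ler_piMr ?(ltW e0)// ler_pdivrMr// mul1r lerDl.
Qed.

Lemma strict_sum (W : normedModType R) (I : finType) (h : I -> V -> W) z L :
  (forall i, strictly_differentiable (h i) z (L i)) ->
  strictly_differentiable (fun y => \sum_i h i y) z (fun v => \sum_i L i v).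
Proof.
move=> hL; elim: (index_enum I) => [|i s IH].
  under eq_fun do rewrite big_nil.
  under [X in strictly_differentiable _ _ X]eq_fun do rewrite big_nil.
  exact: strict_cst.
under eq_fun do rewrite big_cons.
under [X in strictly_differentiable _ _ X]eq_fun do rewrite big_cons.
exact: strict_add.
Qed.

Lemma strict_pair (W X : normedModType R) (h : V -> W) (k : V -> X) z L M :
  strictly_differentiable h z L -> strictly_differentiable k z M ->
  strictly_differentiable (fun y => (h y, k y)) z (fun v => (L v, M v)).
Proof.
move=> [linL [C C0 LC] hL] [linM [D D0 MD] kM]; split.
- by move=> a x y; rewrite linL linM.
- exists (Num.max C D) => [|v]; first by rewrite le_max C0.
  rewrite prod_normE/= ge_max (le_trans (LC v)) ?(le_trans (MD v))//;
    by rewrite ler_wpM2r// le_max lexx ?orbT.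
- move=> e e0.
  have [r r0 hr] := hL _ e0; have [s s0 ks] := kM _ e0.
  exists (Num.min r s) => [|a b]; first by rewrite lt_min r0.
  rewrite !lt_min => /andP[ar as_] /andP[br bs].
  by rewrite prod_normE/= ge_max hr ?ks.
Qed.

Lemma strict_comp (W X : normedModType R) (h : V -> W) (k : W -> X) z L M :
  strictly_differentiable h z L -> strictly_differentiable k (h z) M ->
  strictly_differentiable (k \o h) z (M \o L).
Proof.
move=> sh [linM [D D0 MD] kM].
have [K K0 [t t0 ht]] := strict_lipschitz sh.
have [linL [C C0 LC] hL] := sh; split.
- by move=> a x y; rewrite /= linL linM.
- exists (D * C) => [|v]; first exact: mulr_ge0.
  by rewrite (le_trans (MD _))// -mulrA ler_wpM2l.
- move=> e e0; have D1 : 0 < D + 1 by rewrite ltr_wpDl.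
  have [|r r0 hr] := hL (e / 2 / (D + 1)); first by rewrite !divr_gt0.
  have [|s s0 ks] := kM (e / 2 / K); first by rewrite !divr_gt0.
  have hz a : `|a - z| < t -> `|a - z| < s / K -> `|h a - h z| < s.
    move=> az azs; rewrite (le_lt_trans (ht _ _ az _))// ?subrr ?normr0//.
    by rewrite mulrC -ltr_pdivlMr.
  exists (Num.min r (Num.min t (s / K))) => [|a b].
    by rewrite !lt_min r0 t0 divr_gt0.
  rewrite !lt_min => /and3P[ar at_ as_] /and3P[br bt bs].
  have -> : k (h a) - k (h b) - M (L (a - b)) =
      (k (h a) - k (h b) - M (h a - h b)) + M (h a - h b - L (a - b)).
    by rewrite [M (_ - L _)](linear_propB linM) addrA subrK.
  rewrite [e]splitr mulrDl (le_trans (ler_normD _ _))// lerD//.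
    rewrite (le_trans (ks _ _ (hz _ at_ as_) (hz _ bt bs)))//.
    by rewrite -mulrA ler_wpM2l ?divr_ge0 ?(ltW e0)// mulrC ler_pdivrMr// mulrC ht.
  rewrite (le_trans (MD _))// (le_trans (ler_wpM2l D0 (hr _ _ ar br)))//.
  rewrite mulrA ler_wpM2r// mulrCA ler_piMr ?divr_ge0 ?(ltW e0)//.
  by rewrite ler_pdivrMr// mul1r lerDl.
Qed.

(** Increments are taken from z, since a tent map is compared with the
    identity at its vertex; with L = id this computes the derivative there. *)
Lemma frechet_derive (W : normedModType R) (h : V -> W) z L v : linear L ->
  (forall e : R, 0 < e -> exists2 r : R, 0 < r & forall a, `|a - z| < r ->
    `|h a - h z - L (a - z)| <= e * `|a - z|) ->
  'D_v h z = L v.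
Proof.
move=> linL hL; apply: cvg_lim => //.
apply/cvgrPdist_le => e e0.
have v1 : 0 < `|v| + 1 by rewrite ltr_wpDl.
have [|r r0 hr] := hL (e / (`|v| + 1)); first by rewrite divr_gt0.
near=> t.
have t0 : t != 0 by near: t; exact: nbhs_dnbhs_neq.
have tv : `|t *: v + z - z| < r.
  rewrite addrK normrZ (@le_lt_trans _ _ (`|t| * (`|v| + 1)))//.
    by rewrite ler_wpM2l// lerDl.
  rewrite -ltr_pdivlMr//; near: t; apply: dnbhs0_lt; exact: divr_gt0.
have := hr _ tv; rewrite addrK (linear_propZ linL) => H; rewrite distrC /=.
rewrite -[X in _ - X](@scalerK _ _ t)// -scalerBr normrZ normfV mulrC ler_pdivrMr ?normr_gt0//.
rewrite (le_trans H)// normrZ mulrCA mulrC ler_wpM2r//.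
by rewrite mulrAC ler_pdivrMr// ler_wpM2l ?(ltW e0)// lerDl.
Unshelve. all: by end_near. Qed.

Lemma strict_derive (W : normedModType R) (h : V -> W) z L v :
  strictly_differentiable h z L -> 'D_v h z = L v.
Proof.
move=> [linL _ hL]; apply: frechet_derive => // e /hL[r r0 hr].
by exists r => // a az; apply: hr => //; rewrite subrr normr0.
Qed.

Lemma strict_sub (W : normedModType R) (h k : V -> W) z L M :
  strictly_differentiable h z L -> strictly_differentiable k z M ->
  strictly_differentiable (fun y => h y - k y) z (fun v => L v - M v).
Proof.
move=> sh sk; under eq_fun do rewrite -scaleN1r.
under [X in strictly_differentiable _ _ X]eq_fun do rewrite -scaleN1r.
exact: strict_add sh (strict_scale _ sk).
Qed.

End StrictCalculus.

Lemma le_mulmx_norm (R : realType) (p q r : nat) (A : 'M[R]_(p, q)) (B : 'M[R]_(q, r)) :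
  `|A *m B| <= q%:R * `|A| * `|B|.
Proof.
rewrite {1}/Num.norm /= mx_normrE; apply: bigmax_le => [|[i j] _ /=].
  by rewrite !mulr_ge0.
rewrite mxE (le_trans (ler_norm_sum _ _ _))//.
rewrite -mulrA mulr_natl -[q in _ *+ q]card_ord -sumr_const ler_sum// => k _.
by rewrite normrM ler_pM// le_mx_entry.
Qed.

(** The error of the linearization of a product at (x, y) is a sum of two
    products, each with one factor small near (x, y) and the other one an
    increment. *)
Lemma mulmx_increment (R : realType) (p q r : nat) (a b x : 'M[R]_(p, q))
    (c d y : 'M[R]_(q, r)) :
  a *m c - b *m d - ((a - b) *m y + x *m (c - d)) =
  (a - b) *m (c - y) + (b - x) *m (c - d).
Proof.
rewrite [_ *m (c - y)]mulmxBr [(b - _) *m _]mulmxBl addrACA -opprD.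
by congr (_ - _); rewrite mulmxBl mulmxBr addrA subrK.
Qed.

Lemma strict_mulmx (R : realType) (V : normedModType R) (p q r : nat)
    (A : V -> 'M[R]_(p, q)) (B : V -> 'M[R]_(q, r)) z LA LB :
  strictly_differentiable A z LA -> strictly_differentiable B z LB ->
  strictly_differentiable (fun y => A y *m B y) z
    (fun v => LA v *m B z + A z *m LB v).
Proof.
move=> sA sB.
suff H : strictly_differentiable
    (fun X : 'M[R]_(p, q) * 'M[R]_(q, r) => X.1 *m X.2) (A z, B z)
    (fun X => X.1 *m B z + A z *m X.2).
  exact: strict_comp (strict_pair sA sB) H.
have fstN (X : 'M[R]_(p, q) * 'M[R]_(q, r)) : `|X.1| <= `|X|.
  by rewrite prod_normE le_max lexx.
have sndN (X : 'M[R]_(p, q) * 'M[R]_(q, r)) : `|X.2| <= `|X|.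
  by rewrite prod_normE le_max lexx orbT.
split.
- move=> a X Y /=.
  by rewrite mulmxDl mulmxDr -scalemxAl -scalemxAr scalerDr addrACA.
- exists (q%:R * `|B z| + q%:R * `|A z|) => [|X]; first by rewrite addr_ge0// mulr_ge0.
  rewrite mulrDl (le_trans (ler_normD _ _))// lerD// (le_trans (le_mulmx_norm _ _))//.
    by rewrite mulrAC ler_wpM2l// mulr_ge0.
  by rewrite ler_wpM2l// mulr_ge0.
- move=> e e0; have c0 : 0 < q%:R * 2 + 1 :> R by rewrite ltr_wpDl// mulr_ge0.
  exists (e / (q%:R * 2 + 1)) => [|X Y Xz Yz]; first exact: divr_gt0.
  have -> : X.1 *m X.2 - Y.1 *m Y.2 - ((X - Y).1 *m B z + A z *m (X - Y).2) =
      (X - Y).1 *m (X - (A z, B z)).2 + (Y - (A z, B z)).1 *m (X - Y).2.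
    exact: mulmx_increment.
  rewrite (le_trans (ler_normD _ _))//.
  have bnd (M : 'M[R]_(p, q)) (N : 'M[R]_(q, r)) a b : `|M| <= a -> `|N| <= b ->
      `|M *m N| <= q%:R * (a * b).
    by move=> Ma Nb; rewrite (le_trans (le_mulmx_norm _ _))// -mulrA ler_wpM2l// ler_pM.
  rewrite (le_trans (lerD (bnd _ _ _ _ (fstN _) (le_trans (sndN _) (ltW Xz)))
    (bnd _ _ _ _ (le_trans (fstN _) (ltW Yz)) (sndN _))))//.
  rewrite [_ * `|X - Y|]mulrC -mulr2n -mulrnAl -mulr_natr mulrCA [leRHS]mulrC.
  rewrite ler_wpM2l// mulrA ler_pdivrMr// mulrC ler_wpM2l ?(ltW e0)//.
  by rewrite lerDl.
Qed.

(** A finite system of coordinate functionals of norm at most 1. In the source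
    space it turns pointwise continuity of the derivative into continuity in
    norm; in the target space it reduces the mean value theorem to real-valued
    functions. *)
Definition bounded_coordinates (R : realType) (V : normedModType R) : Prop :=
  exists (I : finType) (b : I -> V) (xi : I -> {linear V -> R}),
    (forall i v, `|xi i v| <= `|v|) /\ (forall v, v = \sum_i xi i v *: b i).

Section C1.
Variables (R : realType).

Lemma bounded_coordinates_real : bounded_coordinates R.
Proof.
exists unit, (fun=> 1), (fun=> idfun); split=> // v.
rewrite (bigD1 tt)//= big1 ?addr0 => [|[]//].
by rewrite /GRing.scale /= mulr1.
Qed.

Lemma bounded_coordinates_mx p q : bounded_coordinates 'M[R]_(p, q).
Proof.
exists ('I_p * 'I_q)%type, (fun ij => delta_mx ij.1 ij.2).
have lin (ij : 'I_p * 'I_q) : linear (fun A : 'M[R]_(p, q) => A ij.1 ij.2).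
  by move=> a A B; rewrite !mxE.
exists (fun ij => HB.pack_for {linear 'M[R]_(p, q) -> R}
  (fun A : 'M[R]_(p, q) => A ij.1 ij.2) (GRing.isLinear.Build _ _ _ _ _ (lin ij))).
split=> [ij v|v] /=; first exact: le_mx_entry.
by rewrite {1}[v]matrix_sum_delta pair_bigA.
Qed.

Lemma bounded_coordinates_prod (V W : normedModType R) :
  bounded_coordinates V -> bounded_coordinates W -> bounded_coordinates (V * W)%type.
Proof.
move=> [I [b [xi [xiN xiE]]]] [J [c [zeta [zetaN zetaE]]]].
have linl (i : I) : linear (fun v : V * W => xi i v.1).
  by move=> a v w; rewrite /= linearP.
have linr (j : J) : linear (fun v : V * W => zeta j v.2).
  by move=> a v w; rewrite /= linearP.
exists (I + J)%type, (fun k => match k with inl i => (b i, 0) | inr j => (0, c j) end).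
exists (fun k => match k with
  | inl i => HB.pack_for {linear (V * W)%type -> R} (fun v : V * W => xi i v.1)
      (GRing.isLinear.Build _ _ _ _ _ (linl i))
  | inr j => HB.pack_for {linear (V * W)%type -> R} (fun v : V * W => zeta j v.2)
      (GRing.isLinear.Build _ _ _ _ _ (linr j))
  end); split.
  move=> [i|j] v /=; rewrite prod_normE le_max.
    by rewrite xiN.
  by rewrite zetaN orbT.
move=> [v w]; rewrite big_sumType /=.
have inlE (s : seq I) : \sum_(i <- s) xi i v *: (b i, 0 : W) =
    (\sum_(i <- s) xi i v *: b i, 0).
  elim: s => [|i s IH]; rewrite ?big_nil// !big_cons IH.
  by congr pair; rewrite /= scaler0 addr0.
have inrE (s : seq J) : \sum_(j <- s) zeta j w *: (0 : V, c j) =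
    (0, \sum_(j <- s) zeta j w *: c j).
  elim: s => [|j s IH]; rewrite ?big_nil// !big_cons IH.
  by congr pair; rewrite /= scaler0 addr0.
by rewrite inlE inrE -xiE -zetaE; congr pair; rewrite /= ?addr0 ?add0r.
Qed.

(** The mean value theorem for s |-> l (h (b + s (a - b))) on [0, 1]. *)
Lemma mean_value (V W : normedModType R) (h : V -> W) (l : {linear W -> R}) (a b : V) :
  continuous l ->
  (forall s : R, s \in `[0, 1] -> differentiable h (b + s *: (a - b))) ->
  exists2 s : R, s \in `[0, 1] &
    l (h a - h b) = l ('d h (b + s *: (a - b)) (a - b)).
Proof.
move=> lc hdiff.
pose phi := fun s : R => l (h (b + s *: (a - b))).
have dphi (s : R) : s \in `[0, 1] -> is_derive s 1 phi (l ('d h (b + s *: (a - b)) (a - b))).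
  move=> /hdiff hs.
  have lhs : differentiable (l \o h) (b + s *: (a - b)).
    by apply: differentiable_comp => //; exact: linear_differentiable.
  have E : (fun t : R => t^-1 *: ((phi \o shift s) (t *: 1) - phi s)) =
     (fun t : R => t^-1 *: (((l \o h) \o shift (b + s *: (a - b))) (t *: (a - b))
        - (l \o h) (b + s *: (a - b)))).
    apply/funext => t; rewrite /phi /=; congr (_ *: (l (h _) - _)).
    by rewrite [t *: 1]mulr1 scalerDl addrCA.
  split; first by rewrite /derivable E; exact: diff_derivable.
  rewrite /derive E -/(derive (l \o h) _ (a - b)) deriveE//.
  by rewrite diff_comp ?diff_lin//; exact: linear_differentiable.
have phic : {within `[0, 1], continuous phi}.
  by apply: derivable_within_continuous => s /dphi[].
pose df := fun s : R => l ('d h (b + s *: (a - b)) (a - b)).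
have dphi' (s : R) : s \in `]0, 1[ -> is_derive s 1 phi (df s).
  by move=> s01; apply: dphi; exact: subset_itv_oo_cc s01.
have [s s01] := MVT_segment ler01 dphi' phic.
rewrite subr0 mulr1 /phi scale1r scale0r addr0 [b + _]addrC subrK => phi01.
by exists s => //; rewrite linearB.
Qed.

(** By the mean value theorem each coordinate of h u - h v - 'd h z (u - v) is
    that of ('d h y - 'd h z) (u - v) for some y between u and v, and this is
    small because 'd h y is close to 'd h z on each of the finitely many basis
    vectors. *)
Lemma strict_C1 (V W : normedModType R) (h : V -> W) z :
  bounded_coordinates V -> bounded_coordinates W ->
  (\forall y \near z, differentiable h y) ->
  (forall v, {for z, continuous (fun y => 'd h y v)}) ->
  strictly_differentiable h z ('d h z).
Proof.
move=> [I [b [xi [xiN xiE]]]] [J [c [zeta [zetaN zetaE]]]] hdiff hc.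
have hz : differentiable h z by exact: nbhs_singleton hdiff.
split.
- exact: linearP.
- have [k k0 hk] := linear_lipschitz (@diff_continuous _ _ _ _ _ hz).
  by exists k => //; exact: ltW.
- move=> e e0.
  (* Each of the #|J| coordinates of the error is at most
     #|I| * (e / K) * |u - v|, and Nb converts coordinates into norms. *)
  pose Nb := \sum_j `|c j|; pose K : R := (Nb * #|I|%:R) + 1.
  have K0 : 0 < K by rewrite ltr_wpDl// mulr_ge0// sumr_ge0.
  have near_d : \forall y \near z, forall i : I, `|'d h y (b i) - 'd h z (b i)| <= e / K.
    apply: filter_forall => i; have /cvgrPdist_le := hc (b i).
    by move=> /(_ (e / K) (divr_gt0 e0 K0)); apply: filterS => y; rewrite distrC.
  have [r /= r0 hr] : nbhs_ball z [set y | differentiable h y /\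
      forall i : I, `|'d h y (b i) - 'd h z (b i)| <= e / K].
    by apply/nbhs_ballP; apply: filterS2 hdiff near_d.
  exists r => // u v uz vz.
  have seg (s : R) : s \in `[0, 1] -> differentiable h (v + s *: (u - v)) /\
      forall i : I, `|'d h (v + s *: (u - v)) (b i) - 'd h z (b i)| <= e / K.
    rewrite in_itv /= => /andP[s0 s1]; apply: hr; rewrite -ball_normE /=.
    have -> : z - (v + s *: (u - v)) = (1 - s) *: (z - v) + s *: (z - u).
      have -> : u - v = (z - v) - (z - u) by rewrite opprB [RHS]addrC addrA subrK.
      rewrite scalerBr opprD opprB addrA scalerBl scale1r -[in RHS]addrA.
      by congr (_ + _); rewrite addrC.
    pose t := Num.max `|u - z| `|v - z|.
    have tr : t < r by rewrite gt_max uz vz.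
    rewrite (le_lt_trans (ler_normD _ _))// !normrZ !ger0_norm ?subr_ge0//.
    rewrite (@le_lt_trans _ _ ((1 - s) * t + s * t))//.
      by rewrite lerD// ler_wpM2l ?subr_ge0// distrC le_max lexx ?orbT.
    by rewrite -mulrDl subrK mul1r.
  have zetac j : continuous (zeta j).
    move=> y; apply/cvgrPdist_le => e1 e10; near=> w.
    rewrite -linearB (le_trans (zetaN _ _))//; near: w; exact: cvgr_dist_le.
  have lin_coord (D : {linear V -> W}) w : D w = \sum_i xi i w *: D (b i).
    by rewrite {1}[w]xiE linear_sum; apply: eq_bigr => i _; rewrite linearZ.
  have entry j : `|zeta j (h u - h v - 'd h z (u - v))| <= #|I|%:R * (e / K) * `|u - v|.
    have [s s01 mv] := mean_value (zetac j) (fun s s01 => (seg s s01).1).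
    rewrite linearB mv -linearB (le_trans (zetaN _ _))//.
    have -> : 'd h (v + s *: (u - v)) (u - v) - 'd h z (u - v) =
      \sum_i xi i (u - v) *: ('d h (v + s *: (u - v)) (b i) - 'd h z (b i)).
      under eq_bigr do rewrite scalerBr.
      by rewrite sumrB [X in X - _]lin_coord [X in _ - X]lin_coord.
    rewrite (le_trans (ler_norm_sum _ _ _))// -mulrA mulr_natl -sumr_const ler_sum// => i _.
    by rewrite normrZ mulrC ler_pM//; exact: (seg s s01).2.
  rewrite [X in `|X|]zetaE (le_trans (ler_norm_sum _ _ _))//.
  under eq_bigr do rewrite normrZ.
  rewrite (@le_trans _ _ (\sum_j (#|I|%:R * (e / K) * `|u - v|) * `|c j|))//.
    by apply: ler_sum => j _; rewrite ler_wpM2r.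
  rewrite -mulr_sumr -/Nb mulrAC ler_wpM2r//.
  rewrite mulrAC mulrA ler_pdivrMr// mulrC ler_wpM2l ?(ltW e0)// mulrC.
  by rewrite lerDl.
Unshelve. all: by end_near. Qed.
End C1.

(** * Multipliers for minimization over a convex set *)

Lemma convex_setP (R : realType) (V : lmodType R) (M : set V) :
  @convex_set R V M <->
  (forall a b (s : R), M a -> M b -> 0 <= s <= 1 -> M (s *: a + (1 - s) *: b)).
Proof.
have convE (l : {i01 R}) (a b : convex_lmodType V) :
  conv l a b = l%:num *: (a : V) + (1 - l%:num) *: (b : V) by [].
split=> [cM a b s Ma Mb /andP[s0 s1]|cM a b l].
  have [l ls] : exists l : {i01 R}, l%:num = s by exists (Itv01 s0 s1).
  have := cM a b l; rewrite !in_setE => /(_ Ma Mb).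
  by rewrite convE ls.
rewrite !in_setE => Ma Mb; rewrite convE.
by apply: cM => //; rewrite ge0 le1.
Qed.

(** The weights c sum to at most 1; the missing weight is put on v. *)
Lemma convex_combination (R : realType) (V : lmodType R) (M : set V) (v : V)
    (I : finType) (k : I -> V) (c : I -> R) :
  @convex_set R V M -> M v -> (forall i, M (k i)) -> (forall i, 0 <= c i) ->
  \sum_i c i <= 1 -> M (v + \sum_i c i *: (k i - v)).
Proof.
move=> /convex_setP cM Mv Mk; elim: (index_enum I) c => [|i s IH] c c0.
  by rewrite !big_nil addr0.
rewrite !big_cons => c1.
have ci1 : c i <= 1.
  by rewrite (le_trans _ c1)// lerDl sumr_ge0.
have [ci|ci] := eqVneq (c i) 1.
  have z : forall j, j \in s -> c j = 0.
    have s0 : \sum_(j <- s) c j == 0.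
      by rewrite eq_le sumr_ge0 ?andbT//; move: c1; rewrite ci gerDl.
    by move: s0; rewrite psumr_eq0// => /allP s0 j js; exact/eqP/(s0 j js).
  rewrite big_seq big1 => [|j js]; last by rewrite z// scale0r.
  by rewrite addr0 ci scale1r addrC subrK.
have ci1' : 0 < 1 - c i by rewrite subr_gt0 lt_neqAle ci.
have := IH (fun j => c j / (1 - c i)).
rewrite -mulr_suml ler_pdivrMr// mul1r lerBrDl => /(_ _ c1) Mw.
have {}Mw := Mw (fun j => divr_ge0 (c0 j) (ltW ci1')).
have := cM _ _ (c i) (Mk i) Mw; rewrite c0 ci1 => /(_ isT).
congr M; rewrite scalerDr scaler_sumr.
under [X in _ + (_ + X) = _]eq_bigr do rewrite scalerA mulrC divfK ?gt_eqF//.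
by rewrite scalerBl scale1r scalerBr !addrA [c i *: k i + v]addrC.
Qed.

Lemma linear_prop_sum (R : realType) (V W : lmodType R) (L : V -> W) (I : finType)
    (c : I -> R) (k : I -> V) :
  linear L -> L (\sum_i c i *: k i) = \sum_i c i *: L (k i).
Proof.
move=> linL; elim: (index_enum I) => [|i s IH].
  by rewrite !big_nil (linear_prop0 linL).
by rewrite !big_cons linL IH.
Qed.

HB.instance Definition _ (R : realType) (n : nat) :=
  Uniform_isComplete.Build 'rV[R]_n cauchy_cvg.

Lemma contraction_closed_ball (R : realType) (X : completeNormedModType R)
    (e : R) (Phi : X -> X) : 0 <= e ->
  (forall w, `|w| <= e -> `|Phi w| <= e) ->
  (forall w w', `|w| <= e -> `|w'| <= e -> `|Phi w - Phi w'| <= 2^-1 * `|w - w'|) ->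
  exists2 w, `|w| <= e & w = Phi w.
Proof.
move=> e0 Phie Phil.
pose B := closed_ball_ Num.norm (0 : X) e.
have BE w : B w <-> `|w| <= e by rewrite /B /closed_ball_ /= sub0r normrN.
have PhiB : set_fun B B Phi by move=> w /BE /Phie /BE.
have half0 : 0 <= 2^-1 :> R by rewrite invr_ge0.
have ctr : is_contraction (mkfun_fun PhiB).
  exists (NngNum half0); split => /=; first by rewrite invf_lt1 ?ltr1n.
  by move=> [a b] [/= /BE ae /BE be]; exact: Phil.
have [||w /BE we wP] := banach_fixed_point ctr.
- exact: closed_closed_ball_.
- by exists 0; apply/BE; rewrite normr0.
- by exists w.
Qed.

Section FritzJohn.
Variables (R : realType) (V : normedModType R) (n : nat).
Variables (G L : V -> 'rV[R]_n) (j0 : 'I_n) (M : set V) (v : V).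
Hypothesis Mv : M v.
Hypothesis convM : @convex_set R V M.
Hypothesis strictG : strictly_differentiable G v L.

Let cone : set 'rV[R]_n :=
  [set y | exists s rho : R, exists k : V,
    [/\ 0 <= s, 0 <= rho, M k & y = s *: L (k - v) + rho *: delta_mx 0 j0]].

(** Convexity of M makes two directions with weights s and s' add up to one
    direction with weight s + s'. *)
Lemma cone_convex : convex_cone cone.
Proof.
have [linL _ _] := strictG.
split.
- by exists 0, 0, v; split=> //; rewrite !scale0r addr0.
- move=> _ _ [s [rho [k [s0 rho0 Mk ->]]]] [s' [rho' [k' [s0' rho0' Mk' ->]]]].
  have [S0|S0] := eqVneq (s + s') 0.
    have [-> ->] : s = 0 /\ s' = 0.
      by move/eqP: S0; rewrite paddr_eq0// => /andP[/eqP -> /eqP ->].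
    exists 0, (rho + rho'), v; split=> //; first exact: addr_ge0.
    by rewrite !scale0r !add0r scalerDl.
  have Sp : 0 < s + s' by rewrite lt_neqAle eq_sym S0 addr_ge0.
  pose t := s / (s + s').
  have t1 : 1 - t = s' / (s + s').
    by rewrite /t -{1}(divff S0) -mulrBl addrC addKr.
  exists (s + s'), (rho + rho'), (t *: k + (1 - t) *: k'); split.
  + exact: addr_ge0.
  + exact: addr_ge0.
  + move/convex_setP : convM; apply => //.
    by rewrite divr_ge0 ?addr_ge0// ler_pdivrMr// mul1r lerDl.
  + rewrite addrACA -scalerDl; congr (_ + _).
    have -> : t *: k + (1 - t) *: k' - v = t *: (k - v) + (1 - t) *: (k' - v).
      by rewrite !scalerBr addrACA -opprD -scalerDl [t + _]addrC subrK scale1r.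
    rewrite linL (linear_propZ linL) scalerDr !scalerA t1.
    by rewrite ![(s + s') * _]mulrC !divfK.
- move=> a _ a0 [s [rho [k [s0 rho0 Mk ->]]]].
  exists (a * s), (a * rho), k; split => //; try exact: mulr_ge0.
  by rewrite scalerDr !scalerA.
Qed.

(** Let d_(j, +) and d_(j, -) be directions into M whose images under L are e_j
    and - e_j, up to a nonnegative amount rho of cost. With
    P w = v + sum_j ((e + w_j) d_(j, +) + e d_(j, -)), all the coefficients lie
    between 0 and 2 e when |w| <= e, so P w belongs to M for e small, and
    L (P w - v) is w up to a nonpositive multiple of the cost direction. A fixed
    point of Phi w = L (P w - v) - (G (P w) - G v) - (e / 2) e_j0 is a w at
    which all coordinates of G but the cost have their value at v, while the
    cost has dropped by at least e / 2. *)
Lemma open_image_not_minimal : (forall y, cone y) ->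
  forall r : R, 0 < r -> exists y, [/\ M y, `|y - v| < r,
    forall j, j != j0 -> G y 0 j = G v 0 j & G y 0 j0 < G v 0 j0].
Proof.
move=> coneT r r0; have [linL _ hG] := strictG.
pose sg (i : 'I_n * bool) : 'rV[R]_n := (-1) ^+ i.2 *: delta_mx 0 i.1.
have /choice[s /choice[rho /choice[k kP]]] i := coneT (sg i).
have s0 i : 0 <= s i by case: (kP i).
have rho0 i : 0 <= rho i by case: (kP i).
have Mk i : M (k i) by case: (kP i).
pose d i := s i *: (k i - v).
have Ld i : L (d i) = sg i - rho i *: delta_mx 0 j0.
  by rewrite (linear_propZ linL); have [_ _ _ ->] := kP i; rewrite addrK.
(* e * D bounds the displacement P w - v and e * S the total weight of the
   convex combination; the tolerance 1 / (2 D) makes Phi a contraction of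
   ratio 1 / 2. *)
pose D : R := 2 * (\sum_i `|d i|) + 1.
pose S : R := 2 * (\sum_i s i) + 1.
have D0 : 0 < D by rewrite ltr_wpDl// mulr_ge0// sumr_ge0.
have S0 : 0 < S by rewrite ltr_wpDl// mulr_ge0// sumr_ge0.
have [|r1 r10 hr1] := hG ((2 * D)^-1); first by rewrite invr_gt0 mulr_gt0.
pose e : R := Num.min S^-1 (Num.min r r1 / (2 * D)).
have rm : 0 < Num.min r r1 by rewrite lt_min r0.
have e0 : 0 < e by rewrite lt_min invr_gt0 S0 divr_gt0// mulr_gt0.
have eS : e * S <= 1 by rewrite -ler_pdivlMr// mul1r ge_min lexx.
have eD : e * D < Num.min r r1.
  rewrite -ltr_pdivlMr// (@le_lt_trans _ _ (Num.min r r1 / (2 * D)))//.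
    by rewrite ge_min lexx orbT.
  by rewrite ltr_pM2l// ltf_pV2 ?posrE ?mulr_gt0// ltr_pMl// ltr1n.
pose t (w : 'rV[R]_n) (i : 'I_n * bool) : R := e + (if i.2 then 0 else w 0 i.1).
pose P w := v + \sum_i t w i *: d i.
have tb w i : `|w| <= e -> 0 <= t w i <= 2 * e.
  move=> we; have : `|if i.2 then 0 else w 0 i.1| <= e.
    case: ifP => _; first by rewrite normr0 ltW.
    exact: le_trans (le_mx_entry _ _ _) we.
  rewrite ler_norml /t => /andP[a b]; apply/andP; split.
    by rewrite -lerBlDl sub0r.
  by rewrite mulrDl mul1r lerD2l.
have MP w : `|w| <= e -> M (P w).
  move=> we; rewrite /P /d; under eq_bigr do rewrite scalerA.
  apply: convex_combination => // [i|]; first by rewrite mulr_ge0//; case/andP: (tb w i we).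
  rewrite (le_trans _ eS)// (@le_trans _ _ (\sum_i 2 * e * s i))//.
    by apply: ler_sum => i _; rewrite ler_wpM2r//; case/andP: (tb w i we).
  by rewrite -mulr_sumr /S mulrDr mulr1 [2 * e]mulrC mulrA lerDl ltW.
have Pv w : `|w| <= e -> `|P w - v| <= e * D.
  move=> we; rewrite /P [v + _]addrC addrK (le_trans (ler_norm_sum _ _ _))//.
  rewrite (@le_trans _ _ (\sum_i 2 * e * `|d i|))//.
    apply: ler_sum => i _; rewrite normrZ ler_wpM2r//.
    by case/andP: (tb w i we) => ? ?; rewrite ger0_norm.
  by rewrite -mulr_sumr /D mulrDr mulr1 [2 * e]mulrC mulrA lerDl ltW.
have PP w w' : `|P w - P w'| <= D * `|w - w'|.
  rewrite /P opprD addrACA subrr add0r -sumrB (le_trans (ler_norm_sum _ _ _))//.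
  rewrite (@le_trans _ _ (\sum_i `|w - w'| * `|d i|))//.
    apply: ler_sum => i _; rewrite -scalerBl normrZ ler_wpM2r//.
    rewrite /t opprD addrACA subrr add0r; case: ifP => _; first by rewrite subrr normr0.
    by have := le_mx_entry (w - w') 0 i.1; rewrite !mxE.
  rewrite -mulr_sumr mulrC ler_wpM2r// /D.
  by rewrite mulr_natl mulr2n -addrA lerDl addr_ge0// sumr_ge0.
have LP w : L (P w - v) = w - (\sum_i t w i * rho i) *: delta_mx 0 j0.
  rewrite /P [v + _]addrC addrK (linear_prop_sum _ _ linL).
  under eq_bigr do rewrite Ld scalerBr [_ *: (rho _ *: _)]scalerA.
  rewrite sumrB -scaler_suml; congr (_ - _).
  rewrite -(pair_bigA _ (fun j b => t w (j, b) *: sg (j, b))) /= [RHS]row_sum_delta.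
  apply: eq_bigr => j _; rewrite big_bool /t /sg /= addr0 expr0 expr1 scale1r.
  by rewrite scaleN1r scalerN scalerDl addKr.
pose Phi w := L (P w - v) - (G (P w) - G v) - (e / 2) *: delta_mx 0 j0.
have near_v w : `|w| <= e -> `|P w - v| < r1.
  by move=> we; rewrite (le_lt_trans (Pv _ we))// (lt_le_trans eD)// ge_min lexx orbT.
have e2 : (2 * D)^-1 * (e * D) = e / 2.
  by rewrite mulrCA invfM -[_ * D]mulrA mulVf ?gt_eqF// mulr1.
have [||w we wPhi] := @contraction_closed_ball R _ e Phi (ltW e0).
- move=> w we; rewrite [leRHS]splitr /Phi (le_trans (ler_normB _ _))// lerD//.
    rewrite distrC (le_trans (hr1 _ _ (near_v w we) _))//; first by rewrite subrr normr0.
    by rewrite -e2 ler_wpM2l ?Pv// invr_ge0 mulr_ge0// ltW.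
  rewrite normrZ ger0_norm ?divr_ge0 ?(ltW e0)// ler_piMr ?divr_ge0 ?(ltW e0)//.
  rewrite /Num.norm /= mx_normrE; apply: bigmax_le => // -[i j] _ /=.
  by rewrite mxE; case: (_ && _); rewrite ?normr1 ?normr0.
- move=> w w' we we'; rewrite /Phi.
  have -> : L (P w - v) - (G (P w) - G v) - (e / 2) *: delta_mx 0 j0 -
     (L (P w' - v) - (G (P w') - G v) - (e / 2) *: delta_mx 0 j0) =
     - (G (P w) - G (P w') - L (P w - P w')).
    have -> : P w - P w' = (P w - v) - (P w' - v) by rewrite opprB addrA subrK.
    by rewrite [L (_ - v - _)](linear_propB linL); apply/matrixP => i j; rewrite !mxE; ring.
  rewrite normrN (le_trans (hr1 _ _ (near_v w we) (near_v w' we')))//.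
  rewrite (le_trans (ler_wpM2l _ (PP w w')))//; first by rewrite invr_ge0 mulr_ge0// ltW.
  by rewrite invfM -mulrA mulKf ?gt_eqF.
have GP : G (P w) = G v - (\sum_i t w i * rho i + e / 2) *: delta_mx 0 j0.
  apply/matrixP => i j; move/matrixP/(_ i j) : wPhi; rewrite /Phi LP !mxE => wPhi.
  by rewrite mulrDl; lra.
exists (P w); split.
- exact: MP.
- by rewrite (le_lt_trans (Pv _ we))// (lt_le_trans eD)// ge_min lexx.
- by move=> j jj0; rewrite GP !mxE (negbTE jj0) andbF mulr0 subr0.
- rewrite GP !mxE !eqxx mulr1 ltrBlDr ltrDl ltr_wpDl ?divr_gt0//.
  by rewrite sumr_ge0// => i _; rewrite mulr_ge0//; case/andP: (tb w i we).
Qed.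

Lemma fritz_john_row :
  (exists2 r : R, 0 < r & forall y, M y -> `|y - v| < r ->
    (forall j, j != j0 -> G y 0 j = G v 0 j) -> G v 0 j0 <= G y 0 j0) ->
  exists w : 'cV[R]_n, [/\ w != 0, 0 <= w j0 0 &
    forall y, M y -> 0 <= (L (y - v) *m w) 0 0].
Proof.
move=> [r r0 vmin]; have [[w w0 wpos]|coneT] := cone_separation cone_convex.
  exists w; split=> // [|y My].
    have := wpos (delta_mx 0 j0); rewrite -rowE mxE; apply.
    by exists 0, 1, v; split=> //; rewrite scale0r add0r scale1r.
  by apply: wpos; exists 1, 0, y; split=> //; rewrite scale0r addr0 scale1r.
have [y [My yv Gy]] := open_image_not_minimal coneT r0.
by rewrite ltNge vmin.
Qed.

End FritzJohn.

Lemma strict_row (R : realType) (V : normedModType R) (n : nat)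
    (G L : 'I_n -> V -> R) (z : V) :
  (forall j, strictly_differentiable (G j) z (L j)) ->
  strictly_differentiable (fun y => \row_j G j y) z (fun v => \row_j L j v).
Proof.
move=> sG.
have inj (j : 'I_n) : strictly_differentiable
    (fun a : R => a *: delta_mx 0 j : 'rV[R]_n) (G j z) (fun a => a *: delta_mx 0 j).
  apply: (@strict_linear _ _ _ _ _ `|delta_mx 0 j : 'rV[R]_n|) => //.
    by move=> a x y; rewrite scalerDl scalerA.
  by move=> a; rewrite normrZ mulrC.
have rowE (w : 'I_n -> R) : \row_j w j = \sum_j w j *: delta_mx 0 j.
  by rewrite [LHS]row_sum_delta; apply: eq_bigr => j _; rewrite mxE.
under eq_fun do rewrite rowE.
under [X in strictly_differentiable _ _ X]eq_fun do rewrite rowE.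
by apply: strict_sum => j; exact: strict_comp (sG j) (inj j).
Qed.

(** Passing from rows to an arbitrary finite family of functions, of which the
    one with index k0 is the objective. *)
Theorem fritz_john (R : realType) (V : normedModType R) (K : finType) (k0 : K)
    (G L : K -> V -> R) (M : set V) (v : V) :
  M v -> @convex_set R V M ->
  (forall k, strictly_differentiable (G k) v (L k)) ->
  (exists2 r : R, 0 < r & forall y, M y -> `|y - v| < r ->
    (forall k, k != k0 -> G k y = G k v) -> G k0 v <= G k0 y) ->
  exists w : K -> R, [/\ exists k, w k != 0, 0 <= w k0 &
    forall y, M y -> 0 <= \sum_k w k * L k (y - v)].
Proof.
move=> Mv convM sG [r r0 vmin].
have sGr : strictly_differentiable
    (fun y => \row_(j < #|K|) G (enum_val j) y) v
    (fun y => \row_(j < #|K|) L (enum_val j) y).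
  by apply: strict_row => j.
have [|w [w0 wk0 wpos]] := fritz_john_row (j0 := enum_rank k0) Mv convM sGr.
  exists r => // y My yv Gy; rewrite !mxE enum_rankK; apply: vmin => // k kk0.
  by have := Gy (enum_rank k); rewrite !mxE enum_rankK (inj_eq enum_rank_inj); apply.
exists (fun k => w (enum_rank k) 0); split=> //.
- apply/not_existsP => wk; case/eqP: w0; apply/matrixP => j i; rewrite ord1 mxE.
  by have := wk (enum_val j); rewrite enum_valK => /negP/negPn/eqP.
- move=> y /wpos; rewrite mxE (reindex enum_rank) /=; last first.
    by apply: onW_bij; exact: enum_rank_bij.
  by under eq_bigr do rewrite mxE enum_rankK mulrC.
Qed.

(** * Inner products, columns and tents *)

Section InnerProduct.
Variables (R : realType) (n : nat).
Implicit Types a b : 'cV[R]_n.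

Lemma inner_linear a : linear (inner a).
Proof.
move=> s b b'; change (inner a (s *: b + b') = s * inner a b + inner a b').
rewrite /inner mulr_sumr -big_split.
by apply: eq_bigr => i _; rewrite !mxE mulrDr mulrCA.
Qed.

Lemma innerC a b : inner a b = inner b a.
Proof. by apply: eq_bigr => i _; rewrite mulrC. Qed.

Lemma inner_suml (I : finType) (P : pred I) (h : I -> 'cV[R]_n) b :
  inner (\sum_(i | P i) h i) b = \sum_(i | P i) inner (h i) b.
Proof.
rewrite innerC (big_morph _ (linear_propD (inner_linear b))
  (linear_prop0 (inner_linear b))).
by apply: eq_bigr => i _; rewrite innerC.
Qed.

Lemma inner_deltar a i : inner a (delta_mx i 0) = a i 0.
Proof.
rewrite /inner (bigD1 i)//= mxE !eqxx mulr1 big1 ?addr0// => j ji.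
by rewrite mxE (negbTE ji) mulr0.
Qed.

Lemma strict_inner (V : normedModType R) a (h : V -> 'cV[R]_n) z L :
  strictly_differentiable h z L ->
  strictly_differentiable (fun y => inner a (h y)) z (fun v => inner a (L v)).
Proof.
move=> sh; apply: (strict_comp sh).
apply: (@strict_linear _ _ _ _ _ (\sum_i `|a i 0|)) => [||b].
- exact: inner_linear.
- exact: sumr_ge0.
- rewrite mulr_suml (le_trans (ler_norm_sum _ _ _))// ler_sum// => i _.
  by rewrite normrM ler_wpM2l// le_mx_entry.
Qed.

Lemma strict_entry (V : normedModType R) (h : V -> 'cV[R]_n) z L i :
  strictly_differentiable h z L ->
  strictly_differentiable (fun y => h y i 0) z (fun v => L v i 0).
Proof.
move=> /(strict_inner (delta_mx i 0)).
by under eq_fun do rewrite innerC inner_deltar;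
  under [X in strictly_differentiable _ _ X]eq_fun do rewrite innerC inner_deltar.
Qed.

Lemma inner_gradient (h : 'cV[R]_n -> R) z L v :
  strictly_differentiable h z L -> inner (gradient h z) v = L v.
Proof.
move=> sh; have [linL _ _] := sh.
have -> : v = \sum_i v i 0 *: delta_mx i 0.
  rewrite {1}[v]matrix_sum_delta; apply: eq_bigr => i _; rewrite big_ord1.
  by [].
rewrite (linear_prop_sum _ _ linL) (linear_prop_sum _ _ (inner_linear _)).
by apply: eq_bigr => i _; rewrite inner_deltar mxE (strict_derive _ sh).
Qed.

End InnerProduct.

Lemma strict_id (R : realType) (V : normedModType R) (z : V) :
  strictly_differentiable id z id.
Proof. by apply: (@strict_linear _ _ _ _ _ 1) => // v; rewrite mul1r. Qed.

Lemma le_col_norm (R : realType) (p n : nat) (j : 'I_n) (A : 'M[R]_(p, n)) :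
  `|col j A| <= `|A|.
Proof.
rewrite [leLHS]/Num.norm /= mx_normrE; apply: bigmax_le => // -[i k] _ /=.
by rewrite mxE le_mx_entry.
Qed.

Lemma strict_col (R : realType) (p n : nat) (j : 'I_n) (z : 'M[R]_(p, n)) :
  strictly_differentiable (col j) z (col j).
Proof.
apply: (@strict_linear _ _ _ _ _ 1) => [||A] //; first by move=> a A B; rewrite linearP.
by rewrite mul1r le_col_norm.
Qed.

Lemma strict_fst (R : realType) (V W : normedModType R) (z : V * W) :
  strictly_differentiable fst z fst.
Proof.
by apply: (@strict_linear _ _ _ _ _ 1) => // v; rewrite mul1r prod_normE le_max lexx.
Qed.

Lemma strict_snd (R : realType) (V W : normedModType R) (z : V * W) :
  strictly_differentiable snd z snd.
Proof.
by apply: (@strict_linear _ _ _ _ _ 1) => // v; rewrite mul1r prod_normE le_max lexx orbT.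
Qed.

Lemma tent_vertex (R : realType) (n : nat) (Omega : set 'cV[R]_n) v Q :
  is_tent Omega v Q -> Q v.
Proof.
move=> [_ _ [K' [[k K'k] K'Z ->]] _].
by exists 0; rewrite ?addr0// -(scale0r k); exact: K'Z.
Qed.

(** The estimate psi z - z = o(z - v) forces psi v = v and makes the derivative
    of psi at v the identity. *)
Lemma tent_retraction (R : realType) (n : nat) (Omega : set 'cV[R]_n) v Q :
  is_tent Omega v Q ->
  exists psi : 'cV[R]_n -> 'cV[R]_n,
    [/\ psi v = v, strictly_differentiable psi v id
      & exists2 eps : R, 0 < eps & forall z, Q z -> `|z - v| < eps -> Omega (psi z)].
Proof.
move=> [_ _ _ [psi [C1psi psio [eps eps0 psiO]]]]; exists psi.
have psioP e : 0 < e -> \forall z \near v, `|psi z - z| <= e * `|z - v|.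
  by move=> e0; have /eqoP/(_ _ e0) := psio.
have psiv : psi v = v.
  have /(_ ltr01)/nbhs_singleton := psioP 1.
  by rewrite subrr normr0 mulr0 normr_le0 subr_eq0 => /eqP.
split=> //; last first.
  exists eps => // z Qz zv; apply: psiO => //.
  by rewrite -ball_normE /ball_ /= distrC.
have spsi : strictly_differentiable psi v ('d psi v).
  apply: strict_C1; try exact: bounded_coordinates_mx.
    by apply: filterS C1psi => z [].
  by have [] := nbhs_singleton C1psi.
suff <- : ('d psi v : _ -> _) = id by [].
apply/funext => w; rewrite -(strict_derive w spsi).
apply: (@frechet_derive _ _ _ psi v id) => // e e0.
have [r r0 hr] : nbhs_ball v [set z | `|psi z - z| <= e * `|z - v|].
  exact/nbhs_ballP/psioP.
exists r => // a av; rewrite psiv opprB addrA subrK; apply: hr.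
by rewrite -ball_normE /ball_ /= distrC.
Qed.

(** * The maximum principle *)

Lemma continuously_differentiable_strict (R : realType) (V W : normedModType R)
    (h : V -> W) z :
  bounded_coordinates V -> bounded_coordinates W -> continuously_differentiable h ->
  strictly_differentiable h z ('d h z).
Proof.
move=> cV cW C1h; apply: strict_C1 => //; last by have [] := C1h z.
by apply: nearW => y; have [] := C1h y.
Qed.

(** Compare the increment of h along a + s (b - a) with the chord, divide by
    s, and let s tend to 0. *)
Lemma convex_above_tangent (R : realType) (V : normedModType R) (D : set V)
    (h : V -> R) (a b : V) L :
  @convex_function R V D h -> D a -> D b -> strictly_differentiable h a L ->
  L (b - a) <= h b - h a.
Proof.
move=> convh Da Db [linL _ hL]; apply/ler_addgt0Pr => e e0.
have n0 : 0 < `|b - a| + 1 by rewrite ltr_wpDl.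
have [|r r0 hr] := hL (e / (`|b - a| + 1)); first by rewrite divr_gt0.
(* The denominator is shifted by 1 to cover the case a = b. *)
pose s := Num.min 1 (r / 2 / (`|b - a| + 1)).
have s0 : 0 < s by rewrite lt_min ltr01 !divr_gt0.
have s1 : s <= 1 by rewrite ge_min lexx.
have [k ks] : exists k : {i01 R}, k%:num = s by exists (Itv01 (ltW s0) s1).
have hs : h (s *: b + (1 - s) *: a) <= s * h b + (1 - s) * h a.
  by have := convh k b a; rewrite !in_setE => /(_ Db Da); rewrite -ks.
have sE : s *: b + (1 - s) *: a = a + s *: (b - a).
  by rewrite scalerBl scale1r scalerBr addrCA [s *: b - _]addrC.
have := hr (a + s *: (b - a)) a; rewrite subrr normr0 r0 [a + _]addrC addrK.
rewrite normrZ gtr0_norm// => /(_ _ isT).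
have -> : s * `|b - a| < r.
  rewrite (@le_lt_trans _ _ (r / 2))// ?ltr_pdivrMr// ?ltr_pMr ?ltr1n//.
  rewrite (@le_trans _ _ (s * (`|b - a| + 1)))//; first by rewrite ler_pM2l// lerDl.
  by rewrite -ler_pdivlMr// ge_min lexx orbT.
move=> /(_ isT); rewrite (linear_propZ linL) => /ler_normlP[+ _].
rewrite opprB -[s *: _ + a]addrC -sE /GRing.scale /= => H.
have H1 : e / (`|b - a| + 1) * (s * `|b - a|) <= s * e.
  rewrite mulrCA ler_pM2l// mulrAC ler_pdivrMr// ler_pM2l// lerDl//.
rewrite -(ler_pM2l s0); lra.
Qed.

Definition stack (R : realType) (p n : nat) (a : 'I_n -> 'cV[R]_p) : 'M[R]_(p, n) :=
  \matrix_(i, t) a t i 0.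

Lemma col_stack (R : realType) (p n : nat) (a : 'I_n -> 'cV[R]_p) t :
  col t (stack a) = a t.
Proof. by apply/matrixP => i j; rewrite !mxE ord1. Qed.

Section Multipliers.
Variables (R : realType) (T d m : nat).
Variables (f : 'I_T -> 'cV[R]_d -> 'cV[R]_d)
  (g : 'I_T -> 'cV[R]_d -> 'M[R]_(d, m))
  (c : 'I_T -> 'cV[R]_d -> 'cV[R]_m -> R)
  (S : 'I_T.+1 -> set 'cV[R]_d)
  (U : 'I_T -> set 'cV[R]_m)
  (W : 'I_m -> {set 'I_T})
  (x : 'I_T.+1 -> 'cV[R]_d) (u : 'I_T -> 'cV[R]_m)
  (q : 'I_T.+1 -> set 'cV[R]_d).
Hypotheses (hf : forall t, continuously_differentiable (f t))
  (hg : forall t, continuously_differentiable (g t))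
  (hc : forall t, continuously_differentiable
          (fun z : 'cV[R]_d * 'cV[R]_m => c t z.1 z.2))
  (U_convex : forall t, @convex_set R 'cV[R]_m (U t))
  (hopt : optimal f g c S U W x u)
  (hq : forall t, is_tent (S t) (x t) (q t)).

Let Df t : 'cV[R]_d -> 'cV[R]_d := 'd (f t) (x (time_now t)).
Let Dg t : 'cV[R]_d -> 'M[R]_(d, m) := 'd (g t) (x (time_now t)).
Let Dc t : 'cV[R]_d * 'cV[R]_m -> R :=
  'd (fun z : 'cV[R]_d * 'cV[R]_m => c t z.1 z.2) (x (time_now t), u t).

Let strict_f t : strictly_differentiable (f t) (x (time_now t)) (Df t).
Proof.
by apply: continuously_differentiable_strict => //; exact: bounded_coordinates_mx.
Qed.

Let strict_g t : strictly_differentiable (g t) (x (time_now t)) (Dg t).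
Proof.
by apply: continuously_differentiable_strict => //; exact: bounded_coordinates_mx.
Qed.

Let strict_c t : strictly_differentiable
  (fun z : 'cV[R]_d * 'cV[R]_m => c t z.1 z.2) (x (time_now t), u t) (Dc t).
Proof.
apply: continuously_differentiable_strict => //.
- by apply: bounded_coordinates_prod; exact: bounded_coordinates_mx.
- exact: bounded_coordinates_real.
Qed.

(** The derivative of the Hamiltonian in the state, at the optimal pair. *)
Definition ham_dx (th : R) (p : 'I_T -> 'cV[R]_d) t (dx : 'cV[R]_d) : R :=
  inner (p t) (Df t dx + Dg t dx *m u t) - th * Dc t (dx, 0).

(** The derivative of the Hamiltonian in the control, at the optimal pair. *)
Definition ham_du (th : R) (gam : 'cV[R]_(freq_dim R W)) (p : 'I_T -> 'cV[R]_d) t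
    (du : 'cV[R]_m) : R :=
  inner (p t) (g t (x (time_now t)) *m du) - th * Dc t (0, du)
  - inner gam (freq_blk R W t *m du).

Lemma strict_hamiltonian_state th gam p t :
  strictly_differentiable
    (fun xi => hamiltonian f g c (W := W) th gam (p t) t xi (u t))
    (x (time_now t)) (ham_dx th p t).
Proof.
have sc := strict_comp (k := fun z : 'cV[R]_d * 'cV[R]_m => c t z.1 z.2)
  (strict_pair (strict_id (x (time_now t))) (strict_cst (u t) (x (time_now t)))) (strict_c t).
have sgu := strict_mulmx (strict_g t) (strict_cst (u t) (x (time_now t))).
have sH := strict_sub (strict_sub (strict_inner (p t) (strict_add (strict_f t) sgu))
  (strict_scale th sc))
  (strict_cst (inner gam (freq_blk R W t *m u t)) (x (time_now t))).
rewrite (_ : ham_dx th p t = (fun v => inner (p t) (Df t v + (Dg t v *m u t + g t (x (time_now t)) *m 0))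
  - th *: Dc t (v, 0) - 0)); first exact: sH.
by apply/funext => v; rewrite mulmx0 addr0 subr0.
Qed.

Local Notation V := ('M[R]_(d, T.+1) * 'M[R]_(m, T))%type.

(** The inequality of [fritz_john] for the substituted problem, with the terms
    sorted by the variable that is moved. The multiplier of the equation
    x_(t+1) - f_t (x_t) - g_t (x_t) u_t = 0 is the costate p_t; the signs are
    those for which the remaining terms are derivatives of the Hamiltonian. *)
Lemma multipliers :
  exists (th : R) (gam : 'cV[R]_(freq_dim R W)) (p : 'I_T -> 'cV[R]_d),
    [/\ 0 <= th, ~ ((forall t, p t = 0) /\ (th = 0 /\ gam = 0)) &
      forall (y : 'I_T.+1 -> 'cV[R]_d) (mu : 'I_T -> 'cV[R]_m),
        (forall t, q t (y t)) -> (forall t, U t (mu t)) ->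
        \sum_t ham_dx th p t (y (time_now t) - x (time_now t))
        + \sum_t ham_du th gam p t (mu t - u t)
        <= \sum_t inner (p t) (y (time_next t) - x (time_next t))].
Proof.
have [[dyn Sx Uu fu0] opt] := hopt.
have /choice[psi psiP] t := tent_retraction (hq t).
pose z0 : V := (stack x, stack u).
pose X t (z : V) : 'cV[R]_d := psi t (col t z.1).
pose Y t (z : V) : 'cV[R]_m := col t z.2.
have X0 t : X t z0 = x t by rewrite /X col_stack; case: (psiP t).
have Y0 t : Y t z0 = u t by rewrite /Y col_stack.
have sX t : strictly_differentiable (X t) z0 (fun z : V => col t z.1).
  have [_ spsi _] := psiP t.
  have scol := strict_comp (strict_fst z0) (strict_col t z0.1).
  have spsi' : strictly_differentiable (psi t) ((col t \o fst) z0) id.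
    by rewrite /= col_stack.
  exact: strict_comp scol spsi'.
have sY t : strictly_differentiable (Y t) z0 (Y t).
  exact: (strict_comp (strict_snd z0) (strict_col t z0.2)).
pose cost (z : V) := \sum_t c t (X (time_now t) z) (Y t z).
pose Dcost (z : V) := \sum_t Dc t (col (time_now t) z.1, Y t z).
have scost : strictly_differentiable cost z0 Dcost.
  apply: strict_sum => t.
  apply: (strict_comp (k := fun z : 'cV[R]_d * 'cV[R]_m => c t z.1 z.2)
    (strict_pair (sX (time_now t)) (sY t))).
  by rewrite X0 Y0.
pose defect t (z : V) := X (time_next t) z -
  (f t (X (time_now t) z) + g t (X (time_now t) z) *m Y t z).
pose Ddefect t (z : V) := col (time_next t) z.1 - (Df t (col (time_now t) z.1) +
  (Dg t (col (time_now t) z.1) *m u t + g t (x (time_now t)) *m Y t z)).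
have sdefect t : strictly_differentiable (defect t) z0 (Ddefect t).
  apply: strict_sub; first exact: sX.
  apply: strict_add.
    by apply: (strict_comp (sX (time_now t))); rewrite X0.
  have sgX : strictly_differentiable (fun z => g t (X (time_now t) z)) z0
      (fun z : V => Dg t (col (time_now t) z.1)).
    by apply: (strict_comp (sX (time_now t))); rewrite X0.
  by have := strict_mulmx sgX (sY t); rewrite X0 Y0.
pose freq (z : V) := freq_map W (fun t => Y t z).
have sfreq : strictly_differentiable freq z0 freq.
  apply: strict_sum => t.
  have := strict_mulmx (strict_cst (freq_blk R W t) z0) (sY t).
  by under [X in strictly_differentiable _ _ X]eq_fun do rewrite mul0mx add0r.
(* The index of the cost, of the components of the dynamics, and of the rows
   of the frequency map. *)
pose K : finType := (unit + ('I_T * 'I_d + 'I_(freq_dim R W)))%type.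
pose G (k : K) (z : V) := match k with
  | inl _ => cost z
  | inr (inl (t, i)) => defect t z i 0
  | inr (inr j) => freq z j 0
  end.
pose L (k : K) (z : V) := match k with
  | inl _ => Dcost z
  | inr (inl (t, i)) => Ddefect t z i 0
  | inr (inr j) => freq z j 0
  end.
have sG k : strictly_differentiable (G k) z0 (L k).
  by case: k => [[]|[[t i]|j]]; [exact: scost|exact: strict_entry|exact: strict_entry].
pose M := [set z : V | (forall t, q t (col t z.1)) /\ (forall t, U t (col t z.2))].
have convM : @convex_set R V M.
  apply/convex_setP => a b s [qa Ua] [qb Ub] s01; split=> t.
    rewrite linearP /= linearZ.
    by have [_ /convex_setP cq _ _] := hq t; exact: cq.
  rewrite linearP /= linearZ.
  by have /convex_setP cU := @U_convex t; exact: cU.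
have qx t : q t (x t) := tent_vertex (hq t).
have Mz0 : M z0 by split=> t; rewrite col_stack.
have [eps eps0 epsP] : exists2 eps : R, 0 < eps &
    forall t z, q t z -> `|z - x t| < eps -> S t (psi t z).
  have /choice[e eP] t : exists e : R, 0 < e /\
      forall z, q t z -> `|z - x t| < e -> S t (psi t z).
    by have [_ _ [e e0 H]] := psiP t; exists e.
  exists (\big[Num.min/1]_t e t).
    by apply: lt_bigmin => // t _; have [] := eP t.
  move=> t z qz zx; apply: (eP t).2 => //; apply: lt_le_trans zx _.
  exact: bigmin_le_cond.
have [|w [[k wk0] w0 wpos]] := fritz_john (k0 := (inl tt : K)) Mz0 convM sG.
  exists eps => // z [qz Uz] zz0 Gz.
  have cost0 : cost z0 = total_cost c x u.
    by apply: eq_bigr => t _; rewrite X0 Y0.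
  (* The state trajectory that competes with x is the image of the columns of z
     under the tent maps, and G z = G z0 says that it is feasible. *)
  rewrite /G cost0; apply: (opt (fun t => X t z) (fun t => Y t z)).
  have defect0 t : defect t z0 = 0 by rewrite /defect !X0 Y0 dyn subrr.
  split.
  - move=> t; apply/eqP; rewrite -subr_eq0; apply/eqP/matrixP => i j.
    rewrite ord1; have := Gz (inr (inl (t, i))) isT.
    by rewrite /G defect0.
  - move=> t; apply: epsP => //; rewrite (le_lt_trans _ zz0)// prod_normE le_max.
    by rewrite -(col_stack x t) -linearB le_col_norm.
  - by move=> t; exact: Uz.
  - apply/matrixP => i j; rewrite ord1; have := Gz (inr (inr i)) isT.
    rewrite /G => ->; rewrite -fu0; congr (freq_map W _ _ _).
    by apply/funext => t; exact: Y0.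
pose p (t : 'I_T) : 'cV[R]_d := \col_i w (inr (inl (t, i))).
pose gam : 'cV[R]_(freq_dim R W) := \col_j w (inr (inr j)).
exists (w (inl tt)), gam, p; split=> //.
  move=> [p0 [th0 gam0]]; move: wk0; case: k => [[]|[[t i]|j]].
  - by rewrite th0 eqxx.
  - by have /matrixP/(_ i 0) := p0 t; rewrite !mxE => ->; rewrite eqxx.
  - by have /matrixP/(_ j 0) := gam0; rewrite !mxE => ->; rewrite eqxx.
move=> y mu qy Umu.
have Myu : M (stack y, stack mu) by split=> t; rewrite col_stack.
have := wpos _ Myu.
set dz := (_ - _).
have dzX t : col t dz.1 = y t - x t by rewrite linearB /= !col_stack.
have dzY t : Y t dz = mu t - u t by rewrite /Y linearB /= !col_stack.
rewrite big_sumType /= (bigD1 tt)//= [X in _ + X + _]big1 ?addr0 => [|[]//].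
rewrite big_sumType /=.
have -> : \sum_(ti : 'I_T * 'I_d) w (inr (inl ti)) *
    L (inr (inl ti)) dz = \sum_t inner (p t) (Ddefect t dz).
  rewrite (eq_bigr (fun ti => w (inr (inl (ti.1, ti.2))) * Ddefect ti.1 dz ti.2 0));
    last by case.
  rewrite -(pair_bigA _ (fun t i => w (inr (inl (t, i))) * Ddefect t dz i 0)) /=.
  by apply: eq_bigr => t _; apply: eq_bigr => i _; congr (_ * _); rewrite mxE.
have -> : \sum_j w (inr (inr j)) * freq dz j 0 =
    \sum_t inner gam (freq_blk R W t *m Y t dz).
  rewrite -(big_morph _ (linear_propD (inner_linear gam))
    (linear_prop0 (inner_linear gam))).
  by apply: eq_bigr => j _; congr (_ * _); rewrite mxE.
move=> pos; rewrite -subr_ge0 -big_split -sumrB /=; apply: (le_trans pos).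
rewrite mulr_sumr -!big_split /=.
rewrite le_eqVlt; apply/orP; left; apply/eqP; apply: eq_bigr => t _.
rewrite /Ddefect /ham_dx /ham_du !dzX dzY.
have [linc _ _] := strict_c t.
have -> : Dc t (y (time_now t) - x (time_now t), mu t - u t) =
    Dc t (y (time_now t) - x (time_now t), 0) + Dc t (0, mu t - u t).
  rewrite -(linear_propD linc); congr (Dc t (_, _)) => /=; by rewrite ?addr0 ?add0r.
rewrite (linear_propB (inner_linear (p t))) addrA !(linear_propD (inner_linear (p t))).
ring.
Qed.

(** Concavity of the Hamiltonian in the control: by [convex_above_tangent] its
    increment from u_t to mu is at most its derivative in the direction
    mu - u_t. *)
Lemma ham_du_maximum (th : R) (gam : 'cV[R]_(freq_dim R W)) p t :
  (forall xi, @convex_function R 'cV[R]_m (U t) (c t xi)) ->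
  0 <= th -> (forall mu, U t mu -> ham_du th gam p t (mu - u t) <= 0) ->
  is_maximum_on (U t)
    (hamiltonian f g c (W := W) th gam (p t) t (x (time_now t)))
    (hamiltonian f g c (W := W) th gam (p t) t (x (time_now t)) (u t)).
Proof.
move=> c_convex th0 du0; have [[_ _ Uu _] _] := hopt.
split=> [|mu Umu]; first by exists (u t).
have sc := strict_comp (k := fun z : 'cV[R]_d * 'cV[R]_m => c t z.1 z.2)
  (strict_pair (strict_cst (x (time_now t)) (u t)) (strict_id (u t))) (strict_c t).
have tangent := convex_above_tangent (c_convex (x (time_now t))) (Uu t) Umu sc.
rewrite -subr_ge0 /hamiltonian.
have := du0 mu Umu; rewrite /ham_du !mulmxBr !(linear_propB (inner_linear _)).
rewrite !(linear_propD (inner_linear _)).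
have := ler_wpM2l th0 tangent; rewrite /= mulrBr.
lra.
Qed.

Lemma gradient_costate th (gam : 'cV[R]_(freq_dim R W)) (p : 'cV[R]_d) t :
  gradient (fun zeta => hamiltonian f g c (W := W) th gam zeta t (x (time_now t)) (u t)) p
  = x (time_next t).
Proof.
have [[dyn _ _ _] _] := hopt; apply/matrixP => i j; rewrite ord1 mxE.
have sH := strict_sub (strict_sub
  (strict_inner (f t (x (time_now t)) + g t (x (time_now t)) *m u t) (strict_id p))
  (strict_cst (th * c t (x (time_now t)) (u t)) p))
  (strict_cst (inner gam (freq_blk R W t *m u t)) p).
under eq_fun do rewrite /hamiltonian innerC.
by rewrite (strict_derive _ sH) /= !subr0 inner_deltar dyn.
Qed.

(** The vector etax is defined by the adjoint equation. The sums over t with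
    time_now t = tau and over s with time_next s = tau have at most one term, and
    the empty ones account for the two endpoint conditions. *)
Theorem maximum_principle :
  (forall t (xi : 'cV[R]_d), @convex_function R 'cV[R]_m (U t) (c t xi)) ->
  exists (etaf : 'I_T -> 'cV[R]_d) (etax : 'I_T.+1 -> 'cV[R]_d)
         (etaC : R) (etau : 'cV[R]_(freq_dim R W)),
    let H := hamiltonian f g c etaC etau in
    0 <= etaC /\
    ~ ((forall t, etaf t = 0) /\ (etaC = 0 /\ etau = 0)) /\
    (forall t : 'I_T,
       x (time_next t) = gradient (fun zeta => H zeta t (x (time_now t)) (u t)) (etaf t)) /\
    (forall s t : 'I_T, t = s.+1 :> nat ->
       etaf s = gradient (fun xi => H (etaf t) t xi (u t)) (x (time_now t))
                - etax (time_now t)) /\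
    (forall t : 'I_T.+1, dual_cone (x t) (q t) (etax t)) /\
    (forall t : 'I_T, t = 0%N :> nat ->
       gradient (fun xi => H (etaf t) t xi (u t)) (x (time_now t)) - etax (time_now t)
       = 0) /\
    (forall t : 'I_T, t.+1 = T -> etaf t = - etax (time_next t)) /\
    (forall t : 'I_T,
       is_maximum_on (U t) (H (etaf t) t (x (time_now t)))
         (H (etaf t) t (x (time_now t)) (u t))) /\
    freq_map W u = 0.
Proof.
move=> c_convex; have [[dyn Sx Uu fu0] opt] := hopt.
have [th [gam [p [th0 nontriv ineq]]]] := multipliers.
pose grad t := gradient
  (fun xi => hamiltonian f g c (W := W) th gam (p t) t xi (u t)) (x (time_now t)).
have gradE t v : inner (grad t) v = ham_dx th p t v.
  exact: inner_gradient (strict_hamiltonian_state th gam p t).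
pose etax (tau : 'I_T.+1) : 'cV[R]_d :=
  \sum_(t | time_now t == tau) grad t - \sum_(s | time_next s == tau) p s.
have qx t : q t (x t) := tent_vertex (hq t).
have now_inj : injective (@time_now T).
  by move=> s t /(congr1 val) /= st; exact: val_inj.
have next_inj : injective (@time_next T) by exact: lift_inj.
have ham_dx0 t : ham_dx th p t 0 = 0.
  by rewrite -gradE (linear_prop0 (inner_linear _)).
have ham_du0 t : ham_du th gam p t 0 = 0.
  rewrite /ham_du !mulmx0 !(linear_prop0 (inner_linear _)).
  have [linc _ _] := strict_c t.
  by rewrite (linear_prop0 linc) mulr0 !subr0.
exists p, etax, th, gam; split=> //; split=> //; split.
  by move=> t; rewrite gradient_costate.
split.
  move=> s t ts; rewrite -/(grad t) /etax (big_pred1 t) => [|t']; last exact: inj_eq.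
  rewrite (big_pred1 s) => [|s']; first by rewrite opprB addrC subrK.
  have -> : time_now t = time_next s by apply: val_inj; rewrite /= ts.
  exact: inj_eq.
split.
  move=> tau y qy.
  pose y' t := if t == tau then y else x t.
  have qy' t : q t (y' t) by rewrite /y'; case: eqP => [->|].
  have y'E t : y' t - x t = if t == tau then y - x tau else 0.
    by rewrite /y'; case: eqP => [->//|_]; rewrite subrr.
  have := ineq y' u qy' Uu.
  rewrite [X in _ + X]big1 ?addr0 => [|t _]; last by rewrite subrr ham_du0.
  rewrite innerC (linear_propB (inner_linear _)) !(innerC (y - x tau)) !inner_suml.
  rewrite subr_le0 [X in _ -> X <= _]big_mkcond [X in _ -> _ <= X]big_mkcond /=.
  rewrite (eq_bigr (fun t => if time_now t == tau then inner (grad t) (y - x tau) else 0)).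
    rewrite [leRHS](eq_bigr (fun s => if time_next s == tau then inner (p s) (y - x tau) else 0))//.
    by move=> s _; rewrite y'E; case: ifP; rewrite ?(linear_prop0 (inner_linear _)).
  by move=> t _; rewrite y'E; case: ifP; rewrite ?gradE.
split.
  move=> t t0; rewrite -/(grad t) /etax (big_pred1 t) => [|t']; last exact: inj_eq.
  rewrite big_pred0 ?subr0 ?subrr// => s.
  by apply/eqP => /(congr1 val) /=; rewrite t0.
split.
  move=> t tT; rewrite /etax big_pred0 => [|s]; last first.
    apply/eqP => /(congr1 val) /= st.
    by have := ltn_ord s; rewrite st /bump /= add1n tT ltnn.
  by rewrite (big_pred1 t) ?sub0r ?opprK// => t'; exact: inj_eq.
split=> // t; apply: ham_du_maximum => // mu Umu.
pose mu' s := if s == t then mu else u s.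
have Umu' s : U s (mu' s) by rewrite /mu'; case: eqP => [->|].
have := ineq x mu' qx Umu'.
rewrite big1 => [|s _]; last by rewrite subrr.
rewrite add0r [leRHS]big1 => [|s _]; last first.
  by rewrite subrr (linear_prop0 (inner_linear _)).
rewrite (bigD1 t)//= big1 ?addr0 => [|s st]; first by rewrite /mu' eqxx.
by rewrite /mu' (negbTE st) subrr.
Qed.

End Multipliers.

Theorem mainTheorem2 (R : realType) (T d m : nat)
  (hT : (0 < T)%N) (hd : (0 < d)%N) (hm : (0 < m)%N)
  (f : 'I_T -> 'cV[R]_d -> 'cV[R]_d)
  (g : 'I_T -> 'cV[R]_d -> 'M[R]_(d, m))
  (c : 'I_T -> 'cV[R]_d -> 'cV[R]_m -> R)
  (S : 'I_T.+1 -> set 'cV[R]_d)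
  (U : 'I_T -> set 'cV[R]_m)
  (W : 'I_m -> {set 'I_T})
  (hf : forall t, continuously_differentiable (f t))
  (hg : forall t, continuously_differentiable (g t))
  (hc : forall t, continuously_differentiable
          (fun z : 'cV[R]_d * 'cV[R]_m => c t z.1 z.2))
  (hS : forall t, S t !=set0)
  (c_convex : forall t (xi : 'cV[R]_d),
     @convex_function R 'cV[R]_m (U t) (c t xi))
  (U_convex : forall t, @convex_set R 'cV[R]_m (U t))
  (U_compact : forall t, compact (U t))
  (U_nonempty : forall t, U t !=set0)
  (x : 'I_T.+1 -> 'cV[R]_d) (u : 'I_T -> 'cV[R]_m)
  (hopt : optimal f g c S U W x u)
  (q : 'I_T.+1 -> set 'cV[R]_d)
  (hq : forall t, is_tent (S t) (x t) (q t)) :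
  exists (etaf : 'I_T -> 'cV[R]_d) (etax : 'I_T.+1 -> 'cV[R]_d)
         (etaC : R) (etau : 'cV[R]_(freq_dim R W)),
    let H := hamiltonian f g c etaC etau in
    0 <= etaC /\
    ~ ((forall t, etaf t = 0) /\ (etaC = 0 /\ etau = 0)) /\
    (forall t : 'I_T,
       x (time_next t) = gradient (fun zeta => H zeta t (x (time_now t)) (u t)) (etaf t)) /\
    (forall s t : 'I_T, t = s.+1 :> nat ->
       etaf s = gradient (fun xi => H (etaf t) t xi (u t)) (x (time_now t))
                - etax (time_now t)) /\
    (forall t : 'I_T.+1, dual_cone (x t) (q t) (etax t)) /\
    (forall t : 'I_T, t = 0%N :> nat ->
       gradient (fun xi => H (etaf t) t xi (u t)) (x (time_now t)) - etax (time_now t)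
       = 0) /\
    (forall t : 'I_T, t.+1 = T -> etaf t = - etax (time_next t)) /\
    (forall t : 'I_T,
       is_maximum_on (U t) (H (etaf t) t (x (time_now t)))
         (H (etaf t) t (x (time_now t)) (u t))) /\
    freq_map W u = 0.
Proof.
exact: (maximum_principle hf hg hc U_convex hopt hq c_convex).
Qed.
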